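(* Let $X$ be a differential equation of order $n$ defined over a finitely generated differential field $K$. (1) Suppose the generic type of $X$ over $K$ is not analyzable in the constants. Then the generic solution of $X$ is not Liouvillian over $K$. (2) Suppose further that $X$ is orthogonal to the constants. Then any solution $f$ of $X$ that is not algebraic over $K$ is not Liouvillian over $K$.
   Context: Everything lies in a saturated model $(\mathcal{U},\delta)$ of $DCF_0$ with field of constants $\mathbb{C}$. $K\langle y\rangle$ is the differential field generated by $y$ over $K$, and $\operatorname{tp}(y/K)$ the complete type of $y$ over $K$. $X$ is identified with its solution set; its order is $\sup\{\operatorname{trdeg}_KK\langle y\rangle: y\in X\}$; a solution $y$ is generic over $K$ if $\operatorname{trdeg}_KK\langle y\rangle$ equals the order, and the generic type of $X$ is $\operatorname{tp}(y/K)$ for $y\in X$ generic. Independence: $y$ is independent from $F\supseteq K$ over $K$ if $K\langle y\rangle$ is algebraically disjoint from $F$ over $K$. A type over $K$ is stationary if it has a unique extension to $K^{alg}$. A complete type $p$ over $K$ is internal to $\mathbb{C}$ if there is a differential field extension $F\supseteq K$ such that every realization $y$ of $p$ lies in $F(c_1,\ldots,c_k)$ for some constants $c_1,\ldots,c_k$; equivalently, for some $F\supseteq K$ and some realization $y$ of $p$ independent from $F$ over $K$, $y\in F(\mathbb{C})$. (Here $F$ ranges over small subfields of $\mathcal{U}$.) $\operatorname{tp}(y/K)$ is analyzable in the constants if there is a sequence $(y_0,\ldots,y_m)$ with $y\in K\langle y_0,\ldots,y_m\rangle^{alg}$ and, for each $i$, either $y_i\in K\langle y_0,\ldots,y_{i-1}\rangle^{alg}$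 or $\operatorname{tp}(y_i/K\langle y_0,\ldots,y_{i-1}\rangle)$ is stationary and internal to $\mathbb{C}$. $X$ is nonorthogonal to the constants if for some (small) differential field extension $F$ of $K$ there is a solution $a$ of $X$ such that $F\langle a\rangle$ contains a constant which is not in $F^{alg}$; otherwise $X$ is orthogonal to the constants. An element is Liouvillian over $K$ if it lies in a differential field $F_m$ where $K=F_0\subset F_1\subset\cdots\subset F_m$ is a tower of differential fields with $F_i=F_{i-1}(\alpha)$ and $\delta\alpha\in F_{i-1}$, or $\delta\alpha/\alpha\in F_{i-1}$, or $\alpha\in F_{i-1}^{alg}$, for each $i$. *)

(* Defs.v *)
From mathcomp Require Import all_boot all_algebra mpoly.
From mathcomp Require Import boolp classical_sets cardinality.

Set Implicit Arguments.
Unset Strict Implicit.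
Unset Printing Implicit Defensive.

Import GRing.Theory.
Local Open Scope ring_scope.
Local Open Scope classical_set_scope.
Local Open Scope card_scope.

(* The language of differential rings with parameters in U. A term in m
   variables is a differential polynomial in m differential unknowns. *)
Inductive dterm (U : Type) (m : nat) : Type :=
| DVar of 'I_m
| DCst of U
| DAdd of dterm U m & dterm U m
| DOpp of dterm U m
| DMul of dterm U m & dterm U m
| DDer of dterm U m.

(* [DEx phi] quantifies the variable of index 0 of [phi]. *)
Inductive dformula (U : Type) (m : nat) : Type :=
| DEq of dterm U m & dterm U m
| DNot of dformula U m
| DAnd of dformula U m & dformula U m
| DEx of dformula U m.+1.

Fixpoint dterm_over (U : Type) (A : set U) (m : nat) (t : dterm U m) : Prop :=
  match t with
  | DVar _ => True
  | DCst a => A a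
  | DAdd t1 t2 | DMul t1 t2 => dterm_over A t1 /\ dterm_over A t2
  | DOpp t1 | DDer t1 => dterm_over A t1
  end.

Fixpoint dformula_over (U : Type) (A : set U) (m : nat) (phi : dformula U m)
    : Prop :=
  match phi with
  | DEq t1 t2 => dterm_over A t1 /\ dterm_over A t2
  | DNot psi => dformula_over A psi
  | DAnd psi1 psi2 => dformula_over A psi1 /\ dformula_over A psi2
  | DEx psi => dformula_over A psi
  end.

Section Fields.
Variable U : fieldType.
Implicit Types (K L F A : set U).

Definition is_subfield F : Prop := divring_closed (mem F).

(* The subfield K(S) of U. *)
Definition gen_field K (S : set U) : set U := smallest is_subfield (K `|` S).

(* The relative algebraic closure of the subfield K in U; it is K^alg when U
   is algebraically closed. *)
Definition alg_closure K : set U :=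
  [set x | exists p : {poly U}, [/\ p \is a polyOver (mem K), p != 0 & root p x]].

Definition alg_indep K (d : nat) (b : d.-tuple U) : Prop :=
  forall p : {mpoly U[d]},
    p \is a mpolyOver d (mem K) -> p.@[tnth b] = 0 -> p = 0.

(* L has a finite transcendence basis of size d over K. *)
Definition has_trdeg K L (d : nat) : Prop :=
  exists b : d.-tuple U,
    [/\ [set` b] `<=` L, alg_indep K b &
        L `<=` alg_closure (gen_field K [set` b])].

(* Cardinality strictly less than that of U. *)
Definition small A : Prop := ~ ([set: U] #<= A).

End Fields.

Section DifferentialFields.
Variables (U : fieldType) (delta : {additive U -> U}).
Implicit Types (K F A : set U).

Fixpoint deval (m : nat) (e : m.-tuple U) (t : dterm U m) : U :=
  match t with
  | DVar i => tnth e i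
  | DCst a => a
  | DAdd t1 t2 => deval e t1 + deval e t2
  | DOpp t1 => - deval e t1
  | DMul t1 t2 => deval e t1 * deval e t2
  | DDer t1 => delta (deval e t1)
  end.

Fixpoint dholds (m : nat) (e : m.-tuple U) (phi : dformula U m) : Prop :=
  match phi with
  | DEq t1 t2 => deval e t1 = deval e t2
  | DNot psi => ~ dholds e psi
  | DAnd psi1 psi2 => dholds e psi1 /\ dholds e psi2
  | DEx psi => exists x : U, dholds [tuple of x :: e] psi
  end.

(* Blum's axioms: f(x, x', ..., x^(n)) has order exactly n, because its last
   variable occurs, and g(x, ..., x^(n-1)) has order less than n. For n = 0
   this says that U is algebraically closed. *)
Record is_DCF0 : Prop := {
  DCF0_leibniz : forall x y, delta (x * y) = delta x * y + x * delta y;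
  DCF0_char : [pchar U] =i pred0;
  DCF0_blum : forall (n : nat) (f : {mpoly U[n.+1]}) (g : {mpoly U[n]}),
    (exists2 mon, mon \in msupp f & mon ord_max != 0%N) -> g != 0 ->
    exists x : U, f.@[fun i : 'I_n.+1 => iter i delta x] = 0 /\
                  g.@[fun i : 'I_n => iter i delta x] != 0
}.

Definition is_saturated : Prop :=
  forall (m : nat) (A : set U) (Gamma : set (dformula U m)),
    small A ->
    (forall phi, Gamma phi -> dformula_over A phi) ->
    (forall D : set (dformula U m), finite_set D -> D `<=` Gamma ->
       exists e : m.-tuple U, forall phi, D phi -> dholds e phi) ->
    exists e : m.-tuple U, forall phi, Gamma phi -> dholds e phi.

(* Uncountability makes finitely generated differential fields small. *)
Record is_universal : Prop := {
  universal_DCF0 : is_DCF0;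
  universal_saturated : is_saturated;
  universal_uncountable : ~ countable [set: U]
}.

Definition constants : set U := [set c | delta c = 0].

Definition is_dfield F : Prop :=
  is_subfield F /\ (forall x, F x -> F (delta x)).

(* K<S>, the differential subfield of U generated by S over K. *)
Definition gen_dfield K (S : set U) : set U := smallest is_dfield (K `|` S).

Definition finitely_generated K : Prop :=
  exists s : seq U, K = gen_dfield set0 [set` s].

(* tp(y/A). *)
Definition tp A (m : nat) (y : m.-tuple U) : set (dformula U m) :=
  [set phi | dformula_over A phi /\ dholds y phi].

(* By saturation, the complete types over a small set are the types of tuples
   of U. *)
Definition complete_type A (m : nat) (p : set (dformula U m)) : Prop :=
  exists y : m.-tuple U, p = tp A y.

Definition stationary K (m : nat) (p : set (dformula U m)) : Prop :=
  exists! q, complete_type (alg_closure K) q /\ p `<=` q.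

Definition internal K (m : nat) (p : set (dformula U m)) : Prop :=
  exists F, [/\ is_dfield F, small F, K `<=` F &
    forall y : m.-tuple U, tp K y = p ->
      exists c : seq U, [set` c] `<=` constants /\
                        [set` y] `<=` gen_field F [set` c]].

(* tp(y/K) is analyzable in the constants; s is the sequence (y_0, ..., y_k),
   and L is K<y_0, ..., y_(i-1)>. *)
Definition analyzable K (m : nat) (y : m.-tuple U) : Prop :=
  exists s : seq U,
    [set` y] `<=` alg_closure (gen_dfield K [set` s]) /\
    forall i, (i < size s)%N ->
      let L := gen_dfield K [set` take i s] in
      alg_closure L s`_i \/
      (stationary L (tp L [tuple s`_i]) /\ internal L (tp L [tuple s`_i])).

(* The solution set of a system E of differential equations in m unknowns. *)
Definition solutions (m : nat) (E : set (dterm U m)) : set (m.-tuple U) :=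
  [set y | forall t, E t -> deval y t = 0].

(* n = sup {trdeg_K K<y> : y in X}. *)
Definition has_order K (m : nat) (X : set (m.-tuple U)) (n : nat) : Prop :=
  (forall y, X y -> exists2 d, has_trdeg K (gen_dfield K [set` y]) d & (d <= n)%N)
  /\ (exists2 y, X y & has_trdeg K (gen_dfield K [set` y]) n).

Definition generic_solution K (m : nat) (X : set (m.-tuple U)) (n : nat)
    (y : m.-tuple U) : Prop :=
  X y /\ has_trdeg K (gen_dfield K [set` y]) n.

Definition nonorthogonal_to_constants K (m : nat) (X : set (m.-tuple U)) : Prop :=
  exists F, [/\ is_dfield F, small F, K `<=` F &
    exists2 a, X a &
    exists c, [/\ gen_dfield F [set` a] c, constants c & ~ alg_closure F c]].

Definition orthogonal_to_constants K (m : nat) (X : set (m.-tuple U)) : Prop :=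
  ~ nonorthogonal_to_constants K X.

(* When alpha = 0 the second alternative reads 0 / 0 = 0, which is harmless. *)
Definition liouvillian K (x : U) : Prop :=
  exists (m : nat) (F : nat -> set U),
    [/\ F 0%N = K,
        (forall i, (i <= m)%N -> is_dfield (F i)),
        (forall i, (i < m)%N -> exists2 alpha : U,
           F i.+1 = gen_field (F i) [set alpha] &
           [\/ F i (delta alpha), F i (delta alpha / alpha) |
               alg_closure (F i) alpha]) &
        F m x].

(* A tuple is Liouvillian (algebraic) when all its coordinates are. *)
Definition liouvillian_tuple K (m : nat) (y : m.-tuple U) : Prop :=
  [set` y] `<=` liouvillian K.

Definition algebraic_tuple K (m : nat) (y : m.-tuple U) : Prop :=
  [set` y] `<=` alg_closure K.

End DifferentialFields.

(* Main.v *)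
From HB Require Import structures.
Require Import Defs.
From mathcomp Require Import all_boot all_algebra mpoly ring.
From mathcomp Require Import boolp classical_sets cardinality.

(** A step of a Liouvillian tower over a differential field L adjoins an x that
    is algebraic over L or satisfies [delta x = a] or [delta x = b * x] with a, b
    in L.  Concatenating the towers of the coordinates of a Liouvillian tuple
    gives one finite sequence of such steps generating the whole tuple
    ([liouvillian_tuple_chain]); the differential fields it passes through are
    countable, hence small.

    Part 1.  Every transcendental step has to have a stationary type that is
    internal to the constants.  It is internal because two solutions of the
    equation of x differ by a constant, respectively by a constant factor
    ([liouville_step_internal]).  It is stationary because the equation has order
    one and is linear: two solutions x, y that are transcendental over L satisfy
    the same algebraic, hence the same differential, equations over L^alg, so
    that by quantifier elimination they have the same type over L^alg
    ([affine_stationary]).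

    Quantifier elimination takes the form of a back-and-forth argument.  An
    isomorphism between two differential subfields of U is handled as its graph:
    a subring of the product ring U * U, stable under inversion and under the
    derivation, in which every nonzero element is invertible ([gfield],
    [dgraph]).  Such a countable graph can be extended to any further element x
    of U ([extend_graph]), and so it preserves all formulas, by induction on the
    formula ([dgraph_elementary]).  For the extension, suppose that
    x, ..., x^(n-1) are algebraically independent over the domain k and that
    x^(n) is algebraic over them.  Take a nonzero F over k of least degree in X_n
    with F(x, ..., x^(n)) = 0.  Blum's axioms and saturation give a y whose first n
    derivatives are independent and with F(y, ..., y^(n)) = 0 ([generic_root]).
    The same F has least degree for y ([minimal_annihilator_transfer]), so
    x^(j) |-> y^(j) defines an isomorphism of fields; it commutes with the
    derivation because, in characteristic zero, a derivation extends uniquely to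
    an algebraic extension ([D_root]).  If x satisfies no differential equation
    over k, a y with the same property does.

    Part 2.  Let x be the first step after which all coordinates of f are
    algebraic.  Some coordinate u of f is algebraic over L(x) and transcendental
    over L, so by exchange x is algebraic over L(u).  Let c be a constant
    transcendental over L<x>, let x0 be [x - c] or [x / c], according to the
    equation of x, and let F = L<x0> = L(x0).  By exchange again, c is
    transcendental over F.  But x and x0 are algebraic over F<f>, and so is c.
    The minimal polynomial of a constant over a differential field has constant
    coefficients ([constant_alg_closure]); hence F<f> contains a constant that is
    transcendental over F ([step_nonorthogonal]). *)

Set Implicit Arguments.
Unset Strict Implicit.
Unset Printing Implicit Defensive.

Import GRing.Theory.
Local Open Scope ring_scope.
Local Open Scope classical_set_scope.

(** * Subfields of commutative rings *)

(** This applies both to subfields of a field U and to graphs in U * U of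
    isomorphisms between subfields of U: in a product ring invertibility of the
    nonzero elements says that neither projection identifies two elements. *)
Definition gfield (R : unitRingType) (S : set R) : Prop :=
  divring_closed (mem S) /\ (forall w, S w -> w != 0 -> w \is a GRing.unit).

Section Closure.
Variables (R : unitRingType) (S : set R) (hS : divring_closed (mem S)).

Lemma dc1 : S 1.
Proof. by case: hS => /set_mem. Qed.

Lemma dcB x y : S x -> S y -> S (x - y).
Proof. by case: hS => _ hB _ /mem_set Sx /mem_set Sy; apply/set_mem/hB. Qed.

Lemma dc_div x y : S x -> S y -> S (x / y).
Proof. by case: hS => _ _ hD /mem_set Sx /mem_set Sy; apply/set_mem/hD. Qed.

Lemma dc0 : S 0.
Proof. by rewrite -(subrr 1); apply: dcB; apply: dc1. Qed.

Lemma dcN x : S x -> S (- x).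
Proof. by move=> Sx; rewrite -sub0r; apply: dcB => //; apply: dc0. Qed.

Lemma dcD x y : S x -> S y -> S (x + y).
Proof. by move=> Sx Sy; rewrite -[y]opprK; apply: dcB => //; apply: dcN. Qed.

Lemma dcV x : S x -> S x^-1.
Proof. by move=> Sx; rewrite -div1r; apply: dc_div => //; apply: dc1. Qed.

Lemma dcM x y : S x -> S y -> S (x * y).
Proof. by move=> Sx Sy; rewrite -[y]invrK; apply: dc_div => //; apply: dcV. Qed.

Lemma dcX x n : S x -> S (x ^+ n).
Proof. by move=> Sx; elim: n => [|n IHn]; rewrite ?exprS; [apply: dc1 | apply: dcM]. Qed.

Lemma dcMn x n : S x -> S (x *+ n).
Proof. by move=> Sx; elim: n => [|n IHn]; rewrite ?mulrS; [apply: dc0 | apply: dcD]. Qed.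

Lemma dc_sum I (r : seq I) (P : pred I) (F : I -> R) :
  (forall i, P i -> S (F i)) -> S (\sum_(i <- r | P i) F i).
Proof. by apply: big_ind => //; [apply: dc0 | apply: dcD]. Qed.

Lemma dc_prod I (r : seq I) (P : pred I) (F : I -> R) :
  (forall i, P i -> S (F i)) -> S (\prod_(i <- r | P i) F i).
Proof. by apply: big_ind => //; [apply: dc1 | apply: dcM]. Qed.

Lemma dc_horner (p : {poly R}) z : (forall i, S p`_i) -> S z -> S p.[z].
Proof.
move=> Sp Sz; rewrite horner_coef; apply: dc_sum => i _.
by apply: dcM => //; apply: dcX.
Qed.

End Closure.

Lemma divring_closedI (R : unitRingType) (S : set R) :
  S 1 -> (forall x y, S x -> S y -> S (x - y)) ->
  (forall x y, S x -> S y -> S (x / y)) -> divring_closed (mem S).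
Proof.
move=> S1 SB SD; split; first exact/mem_set.
- by move=> x y /set_mem Sx /set_mem Sy; apply/mem_set/SB.
- by move=> x y /set_mem Sx /set_mem Sy; apply/mem_set/SD.
Qed.

Section SubType.
Variables (R : comUnitRingType) (S : divringClosed R).

(** The carrier is a new inductive type so that the ring structure induced by
    the ambient ring is attached to it. *)
Inductive subring_of := SubringOf x & x \in S.
Definition subring_val u := let: SubringOf x _ := u in x.

HB.instance Definition _ := [isSub for subring_val].
HB.instance Definition _ := [Choice of subring_of by <:].
HB.instance Definition _ := [SubChoice_isSubComUnitRing of subring_of by <:].

End SubType.

(** Presents a field inside a ring as an abstract field, over which there are
    polynomial rings and Euclidean division. *)
Lemma gfield_embedding (R : comUnitRingType) (S : set R) :
  gfield S ->
  exists (k : fieldType) (i : {rmorphism k -> R}), S = range i.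
Proof.
move=> [hS uS].
pose T : divringClosed R := HB.pack_for (divringClosed R) (fun x : R => x \in S)
  (GRing.isDivringClosed.Build R (fun x : R => x \in S) hS).
have ax : GRing.field_axiom (subring_of T).
  move=> x nx; rewrite qualifE /=; apply: uS; first exact/set_mem/(valP x).
  by apply: contra_neq nx => x0; apply/val_inj; rewrite rmorph0.

pose k : fieldType := HB.pack_for fieldType (subring_of T)
  (GRing.ComUnitRing_isField.Build (subring_of T) ax).
pose i : {rmorphism (subring_of T) -> R} := val.
exists k, i; apply/seteqP; split=> [w Sw | _ [a _ <-]].
  by exists (SubringOf (mem_set Sw : w \in T)).
exact/set_mem/(valP a).
Qed.

Definition fractions (A : comNzRingType) (R : comUnitRingType)
    (e : {rmorphism A -> R}) : set R :=
  [set w | exists a b, e b \is a GRing.unit /\ w = e a / e b].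

(** The hypothesis makes the kernel of [e] prime and says that its image meets
    the non-units in 0 alone; the fractions are then the fraction field of the
    image. *)
Lemma fractions_gfield (A : comNzRingType) (R : comUnitRingType)
    (e : {rmorphism A -> R}) :
  (forall a, e a = 0 \/ e a \is a GRing.unit) -> gfield (fractions e).
Proof.
move=> eP; split; last first.
  move=> _ [a [b [ub ->]]]; case: (eP a) => [->|ua _]; first by rewrite mul0r eqxx.
  by rewrite unitrM ua unitrV.
apply: divring_closedI.
- by exists 1, 1; rewrite rmorph1 unitr1 divr1.
- move=> _ _ [a [b [ub ->]]] [c [d [ud ->]]].
  exists (a * d - c * b), (b * d); rewrite rmorphB !rmorphM unitrM ub ud; split=> //.
  rewrite invrM // mulrBl; congr (_ - _).
    by rewrite [_ / e b]mulrC mulrACA divrr // mulr1.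
  by rewrite mulrACA divrr // mulr1.
- move=> _ _ [a [b [ub ->]]] [c [d [ud ->]]]; case: (eP c) => [->|uc].
    by exists 0, 1; rewrite rmorph0 rmorph1 unitr1 mul0r invr0 mulr0 mul0r.
  exists (a * d), (b * c); rewrite !rmorphM unitrM ub uc; split=> //.
  by rewrite !invrM ?unitrV // invrK [_ / e b]mulrC mulrACA.
Qed.

Lemma fractionsI (A : comNzRingType) (R : comUnitRingType)
    (e : {rmorphism A -> R}) a : fractions e (e a).
Proof. by exists a, 1; rewrite rmorph1 unitr1 divr1. Qed.

Lemma fractions_sub (A : comNzRingType) (R : comUnitRingType)
    (e : {rmorphism A -> R}) (S : set R) :
  divring_closed (mem S) -> (forall a, S (e a)) -> fractions e `<=` S.
Proof. by move=> hS eS _ [a [b [_ ->]]]; apply: dc_div. Qed.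

(** * Derivations *)

Definition dclosed (R : unitRingType) (D : R -> R) (S : set R) : Prop :=
  divring_closed (mem S) /\ (forall x, S x -> S (D x)).

Section Derivation.
Variables (R : comUnitRingType) (D : {additive R -> R}).
Hypothesis DM : forall x y, D (x * y) = D x * y + x * D y.

Lemma D1 : D 1 = 0.
Proof.
have /eqP := DM 1 1; rewrite !mulr1 mul1r -subr_eq0 opprD addNKr oppr_eq0.
by move/eqP.
Qed.

Lemma DV y : y \is a GRing.unit -> D y^-1 = - (y^-1 * y^-1 * D y).
Proof.
move=> uy; apply: (mulrI uy); rewrite mulrN !mulrA divrr // mul1r.
have /esym/eqP := DM y y^-1; rewrite divrr // D1 addrC addr_eq0 => /eqP ->.
by rewrite mulrC.
Qed.

(** Reduces stability under a derivation to a check on generators. *)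
Lemma closed_with_derivative (S : set R) :
  divring_closed (mem S) -> divring_closed (mem [set w | S w /\ S (D w)]).
Proof.
move=> hS; apply: divring_closedI.
- by split; rewrite ?D1; [apply: dc1 | apply: dc0].
- by move=> x y [Sx SDx] [Sy SDy]; split; rewrite ?raddfB; apply: dcB.
- move=> x y [Sx SDx] [Sy SDy]; split; first exact: dc_div.
  have SV : S (D y^-1).
    have [uy|/invr_out-> //] := boolP (y \is a GRing.unit).
    by rewrite DV //; apply: dcN => //; do !apply: dcM => //; apply: dcV.
  by rewrite DM; apply: dcD => //; apply: dcM => //; apply: dcV.
Qed.

(** The chain rule; [map_poly D p] differentiates the coefficients. *)
Lemma D_horner (p : {poly R}) z :
  D p.[z] = (map_poly D p).[z] + p^`().[z] * D z.
Proof.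
elim/poly_ind: p => [|p c IH].
  by rewrite horner0 raddf0 deriv0 !raddf0 !horner0 mul0r addr0.
have -> : map_poly D (p * 'X + c%:P) = map_poly D p * 'X + (D c)%:P.
  apply/polyP=> j; rewrite coef_map !coefD !coefMX !coefC coef_map raddfD /=.
  by case: j => [|j] /=; rewrite ?raddf0.
rewrite !derivE !hornerE raddfD DM IH !mulrDl [_ * D z * z]mulrAC; ring.
Qed.

(** Differentiating [p.[z] = 0] and solving for [D z]: this is why a derivation
    has only one extension to a separable algebraic element. *)
Lemma D_root (S : set R) (p : {poly R}) z :
  divring_closed (mem S) -> (forall j, S p`_j) -> (forall j, S (D p`_j)) -> S z ->
  p.[z] = 0 -> p^`().[z] \is a GRing.unit -> S (D z).
Proof.
move=> hS Sp SDp Sz pz up'.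
have -> : D z = - (map_poly D p).[z] / p^`().[z].
  apply: (mulIr up'); rewrite divrK // mulrC; apply/eqP.
  by rewrite -addr_eq0 addrC -D_horner pz raddf0.
apply: dc_div => //; first apply: dcN => //.
  by apply: dc_horner => // j; rewrite coef_map.
by apply: dc_horner => // j; rewrite coef_deriv; apply: dcMn.
Qed.

Lemma dclosed_fractions (A : comNzRingType) (e : {rmorphism A -> R}) :
  (forall a, e a = 0 \/ e a \is a GRing.unit) ->
  (forall a, fractions e (D (e a))) -> dclosed D (fractions e).
Proof.
move=> eP De; have [hS _] := fractions_gfield eP; split=> // w Sw.
have /(_ w Sw)[]// : fractions e `<=` [set w | fractions e w /\ fractions e (D w)].
apply: fractions_sub; first exact: closed_with_derivative.
by move=> a; split; [apply: fractionsI | apply: De].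
Qed.

End Derivation.

Section Countable.
Variables (R : unitRingType) (D : R -> R).

(** Expressions over [g] for the operations that generate a differential field,
    written as trees with natural leaves, of which there are countably many:
    node 0 is subtraction, node 1 division, node 2 derivation, and any other tree
    stands for 1. *)
Fixpoint field_term (g : nat -> R) (t : GenTree.tree nat) : R :=
  match t with
  | GenTree.Leaf j => g j
  | GenTree.Node 0 [:: a; b] => field_term g a - field_term g b
  | GenTree.Node 1 [:: a; b] => field_term g a / field_term g b
  | GenTree.Node 2 [:: a] => D (field_term g a)
  | _ => 1
  end.

Lemma countable_smallest (S : set R) :
  countable S -> countable (smallest (dclosed D) S).
Proof.
move=> cS.
have [g Sg] : exists g : nat -> R, S `<=` range g.
  have [->|/set0P[s Ss]] := eqVneq S set0; first by exists (fun=> 0) => x [].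
  have /countable_injP[f finj] := cS.
  exists (fun n => if pselect (exists2 x, S x & f x = n) is left e
    then sval (cid2 e) else s).
  move=> x Sx; exists (f x) => //; case: pselect => [e|[]]; last by exists x.
  case: cid2 => /= y Sy fxy; apply: finj => //; exact/mem_set.
apply: (@sub_countable _ _ _ (range (field_term g))); last first.
  apply: card_le_trans (card_image_le _ _) _; exact: countableP.
apply: subset_card_le; apply: smallest_sub.
  split; first apply: divring_closedI.
  - by exists (GenTree.Node 3 [::]).
  - by move=> _ _ [a _ <-] [b _ <-]; exists (GenTree.Node 0 [:: a; b]).
  - by move=> _ _ [a _ <-] [b _ <-]; exists (GenTree.Node 1 [:: a; b]).
  - by move=> _ [a _ <-]; exists (GenTree.Node 2 [:: a]).
by move=> x /Sg[n _ <-]; exists (GenTree.Leaf n).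
Qed.

Lemma smallest_dclosed (S : set R) : dclosed D (smallest (dclosed D) S).
Proof.
split; first apply: divring_closedI.
- by move=> T [[hT _] _]; apply: dc1.
- by move=> x y Sx Sy T hT; apply: dcB (Sx T hT) (Sy T hT); case: hT => -[].
- by move=> x y Sx Sy T hT; apply: dc_div (Sx T hT) (Sy T hT); case: hT => -[].
- by move=> x Sx T hT; have [[_ TD] _] := hT; exact: TD (Sx T hT).
Qed.

End Countable.

(** * Polynomials and algebraic closure *)

Definition poly_eval (k : nzRingType) (R : comNzRingType) (i : {rmorphism k -> R})
    (z : R) : {rmorphism {poly k} -> R} := horner_eval z \o map_poly i.

Lemma poly_evalC (k : nzRingType) (R : comNzRingType) (i : {rmorphism k -> R}) z c :
  poly_eval i z c%:P = i c.
Proof. by rewrite /= map_polyC /horner_eval hornerC. Qed.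

Lemma poly_evalX (k : nzRingType) (R : comNzRingType) (i : {rmorphism k -> R}) z :
  poly_eval i z 'X = z.
Proof. by rewrite /= map_polyX /horner_eval hornerX. Qed.

Lemma minimal_size (A : nzRingType) (Q : {poly A} -> Prop) :
  (exists p, Q p) -> exists2 p, Q p & forall q, Q q -> (size p <= size q)%N.
Proof.
move=> [p Qp]; have ex : exists n, `[< exists2 p, Q p & size p = n >].
  by exists (size p); apply/asboolP; exists p.
case: (ex_minnP ex) => _ /asboolP[p0 Qp0 <-] min_p0; exists p0 => // q Qq.
by apply: min_p0; apply/asboolP; exists q.
Qed.

Lemma deriv_neq0 (A : idomainType) (p : {poly A}) :
  [pchar A] =i pred0 -> (1 < size p)%N -> p^`() != 0.
Proof.
move=> /pcharf0P A0 sp; apply/eqP => /polyP/(_ (size p).-2)/eqP.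
have -> : p^`()`_(size p).-2 = lead_coef p *+ (size p).-1.
  by rewrite coef_deriv prednK // -ltnS prednK // ltnW.
rewrite coef0 -mulr_natr mulf_eq0 A0 lead_coef_eq0 -size_poly_eq0.
by case: (size p) sp => [|[]].
Qed.

Lemma common_denominator (A : comNzRingType) (R : comUnitRingType)
    (e : {rmorphism A -> R}) (p : {poly R}) :
  (forall j, fractions e p`_j) ->
  exists d (P : {poly A}), e d \is a GRing.unit /\ map_poly e P = e d *: p.
Proof.
elim/poly_ind: p => [|p c IH] ep.
  by exists 1, 0; rewrite rmorph1 unitr1 rmorph0 scaler0.
have [|d [P [ud eP]]] := IH.
  by move=> j; have := ep j.+1; rewrite coefD coefMX coefC addr0.
have [a [b [ub]]] := ep 0%N; rewrite coefD coefMX coefC add0r /= => ->.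
exists (d * b), (b *: P * 'X + (d * a)%:P); rewrite rmorphM unitrM ud ub; split=> //.
rewrite rmorphD rmorphM /= map_polyX map_polyZ map_polyC /= eP rmorphM /=.
rewrite scalerDr; congr (_ + _).
  by rewrite scalerA [e b * _]mulrC scalerAl.
by rewrite -mul_polyC -polyCM mulrACA divrr // mulr1.
Qed.

Section AlgebraicClosure.
Variable U : fieldType.
Implicit Types K L : set U.

Lemma subfield_gfield K : is_subfield K -> gfield K.
Proof. by move=> hK; split=> // w _; rewrite unitfE. Qed.

Lemma subfield_embedding K : is_subfield K ->
  exists (k : fieldType) (i : {rmorphism k -> U}), K = range i.
Proof. by move/subfield_gfield/gfield_embedding. Qed.

Lemma polyOver_coef K p : is_subfield K ->
  p \is a polyOver (mem K) <-> (forall j, K p`_j).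
Proof.
move=> hK; split=> [/(all_nthP 0) Kp j|Kp].
  by have [/Kp/set_mem // | /(nth_default 0)->] := ltnP j (size p); apply: dc0.
by apply/(all_nthP 0) => j _; apply/mem_set.
Qed.

Lemma poly_lift (k : fieldType) (i : {rmorphism k -> U}) (p : {poly U}) :
  (forall j, range i p`_j) -> exists q, p = map_poly i q.
Proof.
elim/poly_ind: p => [|p c IH] ip; first by exists 0; rewrite rmorph0.
have [|q ->] := IH.
  by move=> j; have := ip j.+1; rewrite coefD coefMX coefC addr0.
have := ip 0%N; rewrite coefD coefMX coefC add0r /= => -[a _ <-].
by exists (q * 'X + a%:P); rewrite rmorphD rmorphM /= map_polyX map_polyC.
Qed.

Lemma range_subfield (k : fieldType) (i : {rmorphism k -> U}) : is_subfield (range i).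
Proof.
apply: divring_closedI; first by exists 1; rewrite ?rmorph1.
- by move=> _ _ [a _ <-] [b _ <-]; exists (a - b); rewrite ?rmorphB.
- by move=> _ _ [a _ <-] [b _ <-]; exists (a / b); rewrite ?fmorph_div.
Qed.

(** Links the closure of a subset with algebraicity over an abstract field, for
    which sums, products and towers are known to be algebraic. *)
Lemma alg_closureP (k : fieldType) (i : {rmorphism k -> U}) x :
  alg_closure (range i) x <-> algebraicOver i x.
Proof.
have hK := range_subfield i; split=> [[p [/(polyOver_coef _ hK) Kp np px]]|[p np px]].
  have [q pq] := poly_lift Kp; exists q; last by rewrite -pq.
  by apply: contra_neq np => q0; rewrite pq q0 rmorph0.
exists (map_poly i p); split=> //; last by rewrite map_poly_eq0.
by apply/polyOver_coef => // j; rewrite coef_map; exists p`_j.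
Qed.

Lemma sub_alg_closure K : is_subfield K -> K `<=` alg_closure K.
Proof.
move=> /subfield_embedding[k [i ->]] _ [a _ <-].
exact/alg_closureP/algebraic_id.
Qed.

Lemma alg_closureS K L : K `<=` L -> alg_closure K `<=` alg_closure L.
Proof.
move=> KL x [p [Kp np px]]; exists p; split=> //.
by apply: sub_all Kp => y /set_mem/KL/mem_set.
Qed.

Lemma alg_closure_subfield K : is_subfield K -> is_subfield (alg_closure K).
Proof.
move=> /subfield_embedding[k [i ->]]; apply: divring_closedI.
- exact/alg_closureP/algebraic1.
- by move=> x y /alg_closureP ax /alg_closureP ay; apply/alg_closureP/algebraic_sub.
- by move=> x y /alg_closureP ax /alg_closureP ay; apply/alg_closureP/algebraic_div.
Qed.

Lemma alg_closure_idem K : is_subfield K ->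
  alg_closure (alg_closure K) `<=` alg_closure K.
Proof.
move=> hK x [p [Kp np px]]; have [k [i KE]] := subfield_embedding hK.
rewrite KE in Kp *; apply/alg_closureP/integral_algebraic; apply: integral_root np px _.
by move=> c /(allP Kp)/set_mem/alg_closureP/integral_algebraic.
Qed.

Lemma gen_field_subfield K (S : set U) : is_subfield (gen_field K S).
Proof.
apply: divring_closedI.
- by move=> T [hT _]; apply: dc1.
- by move=> x y Sx Sy T hT; apply: dcB (Sx T hT) (Sy T hT); case: hT.
- by move=> x y Sx Sy T hT; apply: dc_div (Sx T hT) (Sy T hT); case: hT.
Qed.

Lemma gen_fieldP K (S : set U) : K `|` S `<=` gen_field K S.
Proof. exact: sub_gen_smallest. Qed.

Lemma gen_field1_fractions (k : fieldType) (i : {rmorphism k -> U}) a :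
  gen_field (range i) [set a] `<=` fractions (poly_eval i a).
Proof.
apply: smallest_sub; first apply: (proj1 (fractions_gfield _)).
  by move=> p; have [->|?] := eqVneq (poly_eval i a p) 0; [left | right; rewrite unitfE].
move=> _ [[c _ <-]|->].
  by rewrite -(poly_evalC i a); apply: fractionsI.
by rewrite -{2}(poly_evalX i a); apply: fractionsI.
Qed.

(** Clearing denominators, b is a root of P(a, Y) for a nonzero polynomial P over
    K.  Read in the other variable, a is a root of P(X, b), which is not zero
    because b is transcendental. *)
Lemma alg_closure_exchange K a b : is_subfield K ->
  alg_closure (gen_field K [set a]) b -> ~ alg_closure K b ->
  alg_closure (gen_field K [set b]) a.
Proof.
move=> hK [p [Kp np pb]] nb; have [k [i KE]] := subfield_embedding hK.
have [|d [P [ud dP]]] := @common_denominator _ _ (poly_eval i a) p.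
  move=> j; apply: gen_field1_fractions; rewrite -KE.
  by move/polyOver_coef: Kp; apply; apply: gen_field_subfield.
have nP : P != 0.
  apply: contraTneq ud => P0; rewrite unitfE negbK.
  by move/eqP: dP; rewrite P0 rmorph0 eq_sym scaler_eq0 (negPf np) orbF.
have Pba : (map_poly (poly_eval i b) (swapXY P)).[a] = 0.
  have ev (u : {poly {poly k}}) x y : (map_poly (poly_eval i x) u).[y] =
      (map_poly (map_poly i) u).[y, x].
    have {1}<- : horner_eval x y%:P = y by rewrite /horner_eval hornerC.
    by rewrite map_poly_comp horner_map.
  rewrite ev -swapXY_map horner_swapXY -map_poly_comp [map_poly _ _]dP.
  by rewrite hornerZ (rootP pb) mulr0.
exists (map_poly (poly_eval i b) (swapXY P)); split; last exact/rootP.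
- apply/polyOver_coef => [|j]; first exact: gen_field_subfield.
  rewrite coef_map; apply: (dc_horner (gen_field_subfield _ _)).
    move=> l; apply: gen_fieldP; left; rewrite KE.
    by rewrite coef_map; exists ((swapXY P)`_j)`_l.
  by apply: gen_fieldP; right.
- apply/eqP => P0; apply: nb; rewrite KE; apply/alg_closureP.
  have [j nj] : exists j, (swapXY P)`_j != 0.
    apply: contrapT => /forallNP all0; move/eqP: nP; apply; apply/eqP.
    rewrite -swapXY_eq0.
    by apply/eqP/polyP=> j; have /negP := all0 j; rewrite negbK coef0 => /eqP.
  exists ((swapXY P)`_j) => //; apply/rootP.
  by move/polyP: P0 => /(_ j); rewrite coef_map coef0.
Qed.

End AlgebraicClosure.

Section DifferentialClosure.
Variables (U : fieldType) (delta : {additive U -> U}).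
Hypothesis dM : forall x y, delta (x * y) = delta x * y + x * delta y.
Hypothesis U0 : [pchar U] =i pred0.
Implicit Types K F : set U.

Lemma gen_dfield_dfield K S : is_dfield delta (gen_dfield delta K S).
Proof. exact: (smallest_dclosed delta (K `|` S)). Qed.

Lemma gen_dfieldP K S : K `|` S `<=` gen_dfield delta K S.
Proof. exact: sub_gen_smallest. Qed.

Lemma gen_dfield_min K S F :
  is_dfield delta F -> K `<=` F -> S `<=` F -> gen_dfield delta K S `<=` F.
Proof. by move=> hF KF SF; apply: smallest_sub => // x []; [apply: KF | apply: SF]. Qed.

Lemma root_size_gt1 (p : {poly U}) x : p != 0 -> root p x -> (1 < size p)%N.
Proof.
move=> np px; rewrite ltnNge; apply: contra np => /size1_polyC pc.
by move: px; rewrite pc rootE hornerC polyC_eq0.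
Qed.

(** A polynomial p of least degree vanishing at x has [p^`().[x] != 0], as the
    characteristic is zero, so [D_root] applies. *)
Lemma alg_closure_dfield K : is_dfield delta K -> is_dfield delta (alg_closure K).
Proof.
move=> [hK dK]; have hA := alg_closure_subfield hK; split=> // x.
move=> /minimal_size[p [Kp np px] min_p].
have sp := root_size_gt1 np px.
apply: (D_root dM hA) (rootP px) _ => [j|j||].
- exact/sub_alg_closure/(polyOver_coef _ hK).1.
- exact/sub_alg_closure/dK/(polyOver_coef _ hK).1.
- by exists p.
- rewrite unitfE; apply/negP => /eqP/rootP p'x.
  have := lt_size_deriv np; rewrite ltnNge min_p //; split=> //.
    apply/polyOver_coef => // j; rewrite coef_deriv; apply: dcMn => //.
    exact: (polyOver_coef _ hK).1.
  exact: deriv_neq0.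
Qed.

(** Let p be the minimal polynomial of the constant c.  Differentiating p(c) = 0
    shows that c is a root of the polynomial of the derivatives of the
    coefficients of p.  Its degree is smaller, since p is monic; so it is zero and
    the coefficients of p are constants. *)
Lemma constant_alg_closure F c : is_dfield delta F ->
  constants delta c -> alg_closure F c -> alg_closure (F `&` constants delta) c.
Proof.
move=> [hF dF] dc /minimal_size[p0 [Fp0 np0 p0c] min_p0].
pose p := (lead_coef p0)^-1 *: p0.
have Fp j : F p`_j.
  rewrite coefZ; apply: dcM => //; last exact: (polyOver_coef _ hF).1.
  by apply: dcV => //; rewrite lead_coefE; apply: (polyOver_coef _ hF).1.
have lp0 : lead_coef p0 != 0 by rewrite lead_coef_eq0.
have pm : lead_coef p = 1 by rewrite lead_coefZ mulVf.
have szp : size p = size p0 by rewrite size_scale // invr_eq0.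
have np : p != 0 by rewrite -lead_coef_eq0 pm oner_neq0.
have pc : p.[c] = 0 by rewrite hornerZ (rootP p0c) mulr0.
have dp0 : map_poly delta p = 0.
  apply/eqP; apply: contraT => ndp; suff: (size p <= size (map_poly delta p))%N.
    rewrite leqNgt => /negP[]; rewrite ltn_neqAle size_poly andbT.
    apply: contra_neq ndp => szd; apply/eqP; rewrite -lead_coef_eq0 lead_coefE szd.
    by rewrite coef_map -lead_coefE pm /= (D1 dM).
  rewrite szp; apply: min_p0; split=> //.
    by apply/polyOver_coef => // j; rewrite coef_map; apply: dF.
  apply/rootP; have := D_horner dM p c.
  by rewrite pc raddf0 (_ : delta c = 0) // mulr0 addr0.
exists p; split=> //; last exact/rootP.
apply/(all_nthP 0) => j _; apply/mem_set; split=> //.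
by move/polyP: dp0 => /(_ j); rewrite coef_map coef0.
Qed.

End DifferentialClosure.

(** * Multivariate polynomials *)

(** The point is an infinite sequence, so that polynomials in different numbers
    of variables are evaluated at initial segments of one jet. *)
Definition mpoly_eval (k : nzRingType) (R : comNzRingType) (f : {rmorphism k -> R})
    (z : nat -> R) (n : nat) : {rmorphism {mpoly k[n]} -> R} :=
  mmap f (fun j : 'I_n => z j).

Section Multivariate.
Variables (k : nzRingType) (R : comNzRingType) (f : {rmorphism k -> R}).

Lemma mmapEsupp n (h : 'I_n -> R) p :
  mmap f h p = \sum_(m <- msupp p) f p@_m * \prod_j h j ^+ m j.
Proof. by []. Qed.

Lemma meval_map_mpoly n (h : 'I_n -> R) p : (map_mpoly f p).@[h] = mmap f h p.
Proof.
rewrite [RHS]mmapEsupp /map_mpoly /mmap rmorph_sum /=; apply: eq_bigr => m _.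
by rewrite mevalM mevalC mmap1_id mevalX.
Qed.

Lemma mmap_mwiden n (h : 'I_n.+1 -> R) p :
  mmap f h (mwiden p) = mmap f (fun j => h (widen_ord (leqnSn n) j)) p.
Proof.
transitivity (mmap f h (\sum_(m <- msupp p)
    (p@_m)%:MP * \prod_j 'X_(widen_ord (leqnSn n) j) ^+ m j)); first by [].
rewrite [RHS]mmapEsupp rmorph_sum /=; apply: eq_bigr => m _.
rewrite rmorphM /= mmapC rmorph_prod /=; congr (_ * _); apply: eq_bigr => j _.
by rewrite rmorphXn /= mmapX mmap1U.
Qed.

Lemma mmap_mmulti n (h : 'I_n.+1 -> R) (F : {poly {mpoly k[n]}}) :
  mmap f h (mmulti F) =
  (map_poly (mmap f (fun j => h (widen_ord (leqnSn n) j))) F).[h ord_max].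
Proof.
rewrite /mmulti rmorph_sum /= (horner_coef_wide _ (size_poly _ _)).
apply: eq_bigr => j _; rewrite rmorphM /= mmap_mwiden rmorphXn /= mmapX mmap1U.
by rewrite coef_map.
Qed.

Lemma mmap_muni n (h : 'I_n.+1 -> R) (P : {mpoly k[n.+1]}) :
  mmap f h P =
  (map_poly (mmap f (fun j => h (widen_ord (leqnSn n) j))) (muni P)).[h ord_max].
Proof.
rewrite muniE rmorph_sum horner_sum mmapEsupp; apply: eq_bigr => m _.
rewrite big_ord_recr /= map_polyZ hornerZ map_polyXn hornerXn mulrA; congr (_ * _).
rewrite [RHS]mmapZ mmapX; congr (_ * _); apply: eq_bigr => j _; by rewrite mnmE.
Qed.

End Multivariate.

Lemma mmap_comp (k : nzRingType) (R S : comNzRingType) (f : {rmorphism k -> R})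
    (g : {rmorphism R -> S}) n (h : 'I_n -> R) p :
  g (mmap f h p) = mmap (g \o f) (g \o h) p.
Proof.
rewrite !mmapEsupp rmorph_sum; apply: eq_bigr => m _ /=.
by rewrite rmorphM rmorph_prod; congr (_ * _); apply: eq_bigr => j _; rewrite rmorphXn.
Qed.

Section MultivariateField.
Variable k : fieldType.

Lemma mpoly0_const (p : {mpoly k[0]}) : p = (p@_0)%:MP.
Proof.
apply/mpolyP=> m; rewrite mcoeffC.
have -> : m = 0%MM by apply/mnmP => -[].
by rewrite eqxx mulr1.
Qed.

(** Evaluating at the generic point ['X_0, ..., 'X_n] recovers P from
    [muni P]. *)
Lemma muni_eq0 n (P : {mpoly k[n.+1]}) : muni P = 0 -> P = 0.
Proof.
move=> P0; have := mmap_muni (@mpolyC n.+1 k) (fun j => 'X_j) P.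
rewrite P0 rmorph0 horner0 => <-.
rewrite mmapEsupp {1}[P]mpolyE; apply: eq_bigr => m _.
by rewrite mul_mpolyC; congr (_ *: _); rewrite [LHS]mpolyXE_id.
Qed.

(** If the last variable did not occur, evaluating it at ['X] or at 0 would give
    the same result; but these evaluations give F and its constant term. *)
Lemma mmulti_last_variable n (F : {poly {mpoly k[n]}}) : (1 < size F)%N ->
  exists2 m, m \in msupp (mmulti F) & m ord_max != 0%N.
Proof.
move=> sF; apply: contrapT => /forall2NP noX.
have last0 m : m \in msupp (mmulti F) -> m ord_max = 0%N.
  by move=> mF; have [/(_ mF)//|/negP] := noX m; rewrite negbK => /eqP.
pose g (c : {poly {mpoly k[n]}}) (j : 'I_n.+1) : {poly {mpoly k[n]}} :=
  if unlift ord_max j is Some l then ('X_l)%:P else c.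
pose f : {rmorphism k -> {poly {mpoly k[n]}}} := polyC \o @mpolyC n k.
have gE c : mmap f (g c) (mmulti F) = (map_poly polyC F).[c].
  rewrite mmap_mmulti /g unlift_none; congr (_.[_]).
  apply: eq_map_poly => p; rewrite mmapEsupp [in RHS](mpolyE p) rmorph_sum.
  apply: eq_bigr => m _ /=; rewrite -mul_mpolyC rmorphM /=; congr (_ * _).
  rewrite mpolyXE_id rmorph_prod; apply: eq_bigr => j _.
  by rewrite (_ : widen_ord _ j = lift ord_max j) ?liftK ?rmorphXn //;
    apply/val_inj; rewrite /= /bump leqNgt ltn_ord.
have : mmap f (g 'X) (mmulti F) = mmap f (g 0) (mmulti F).
  rewrite !mmapEsupp !big_seq; apply: eq_bigr => m /last0 m0; congr (_ * _).
  rewrite !big_ord_recr /= m0 !expr0; congr (_ * _); apply: eq_bigr => j _.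
  rewrite /g (_ : widen_ord _ j = lift ord_max j) ?liftK //.
  by apply/val_inj; rewrite /= /bump leqNgt ltn_ord.
rewrite !gE -[0]/(polyC 0) horner_map -/(comp_poly _ _) comp_polyXr => FE.
by move: sF; rewrite FE size_polyC; case: eqP.
Qed.

End MultivariateField.

Lemma poly_as_mpoly (k : fieldType) (p : {poly k}) : exists P : {mpoly k[1]},
  (p != 0 -> P != 0) /\
  forall (R : comNzRingType) (f : {rmorphism k -> R}) z,
    mpoly_eval f z 1 P = (map_poly f p).[z 0%N].
Proof.
exists (mmulti (map_poly (@mpolyC 0 k) p)).
have ev (R : comNzRingType) (f : {rmorphism k -> R}) z :
    mpoly_eval f z 1 (mmulti (map_poly (@mpolyC 0 k) p)) = (map_poly f p).[z 0%N].
  rewrite /= mmap_mmulti -map_poly_comp; congr (_.[_]); apply: eq_map_poly => c /=.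
  exact: mmapC.
split=> //; apply: contra_neq => P0.
have := ev _ (@polyC k) (fun=> 'X); rewrite P0 rmorph0.
by rewrite -/(comp_poly _ _) comp_polyXr.
Qed.

Lemma mpoly_widen (k : fieldType) n N (Q : {mpoly k[n]}) : (n <= N)%N ->
  exists Q' : {mpoly k[N]}, (Q != 0 -> Q' != 0) /\
    forall (R : comNzRingType) (f : {rmorphism k -> R}) z,
      mpoly_eval f z N Q' = mpoly_eval f z n Q.
Proof.
move=> /subnK <-; elim: (N - n)%N => [|d [Q' [nQ' evQ']]]; first by exists Q.
exists (mwiden Q'); split=> [/nQ'|R f z].
  by apply: contra_neq => Q0; apply: inj_mwiden; rewrite Q0 rmorph0.
by rewrite -evQ' /= mmap_mwiden.
Qed.

(** * Saturation and generic solutions *)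

Section Saturation.
Variables (U : fieldType) (delta : {additive U -> U}).
Hypothesis HU : is_universal delta.

Lemma tuple1E (T : Type) (e : 1.-tuple T) : e = [tuple tnth e ord0].
Proof. by apply: eq_from_tnth => j; rewrite (ord1 j) tnth0. Qed.

Lemma countable_small (A : set U) : countable A -> small A.
Proof.
by move=> cA UA; apply: (universal_uncountable HU); apply: sub_countable UA cA.
Qed.

(** Saturation for quantifier-free types.  The hypothesis on pairs says that two
    inequations follow from a single one, so every finite part of the type
    follows from the equations and one inequation. *)
Lemma compactness (A : set U) (I : Type) (E : set (dterm U 1)) (N : I -> dterm U 1) :
  small A -> A 0 -> (forall t, E t -> dterm_over A t) ->
  (forall i, dterm_over A (N i)) -> inhabited I ->
  (forall i j, exists l, forall y : U, deval delta [tuple y] (N l) <> 0 ->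
     deval delta [tuple y] (N i) <> 0 /\ deval delta [tuple y] (N j) <> 0) ->
  (forall i, exists2 y, forall t, E t -> deval delta [tuple y] t = 0 &
     deval delta [tuple y] (N i) <> 0) ->
  exists2 y, forall t, E t -> deval delta [tuple y] t = 0 &
    forall i, deval delta [tuple y] (N i) <> 0.
Proof.
move=> sA A0 EA NA [i0] Nprod Nsat.
pose Gamma : set (dformula U 1) := [set phi |
  (exists2 t, E t & phi = DEq t (DCst 1 0)) \/
  (exists i, phi = DNot (DEq (N i) (DCst 1 0)))].
have fin (s : seq {classic dformula U 1}) : (forall phi, phi \in s -> Gamma phi) ->
    exists i, forall y, (forall t, E t -> deval delta [tuple y] t = 0) ->
      deval delta [tuple y] (N i) <> 0 ->
      forall phi, phi \in s -> dholds delta [tuple y] phi.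
  elim: s => [|phi s IHs] Gs; first by exists i0.
  have [|i Hi] := IHs; first by move=> psi psis; apply: Gs; rewrite inE psis orbT.
  have [[t Et phiE]|[j phiE]] := Gs phi (mem_head _ _).
    exists i => y Ey Ny psi; rewrite inE => /orP[/eqP->|/Hi]; last exact.
    by rewrite phiE /=; apply: Ey.
  have [l Hl] := Nprod i j; exists l => y Ey /Hl[Niy Njy] psi.
  by rewrite inE => /orP[/eqP->|/Hi]; [rewrite phiE | apply].
have [phi|D finD DG|e He] := universal_saturated HU (Gamma := Gamma) sA.
- by move=> [[t /EA At ->]|[i ->]] /=; split.
- have [s Ds] := (@finite_seqP {classic dformula U 1} D).1 finD.
  have [phi phis|i Hi] := fin s; first by apply: DG; rewrite Ds.
  by have [y Ey Ny] := Nsat i; exists [tuple y] => phi; rewrite Ds => /Hi; apply.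
- exists (tnth e ord0) => [t Et|i]; rewrite -tuple1E.
    by apply: (He (DEq t (DCst 1 0))); left; exists t.
  by apply: (He (DNot (DEq (N i) (DCst 1 0)))); right; exists i.
Qed.

Definition jet (y : U) (j : nat) : U := iter j delta y.

Section Generic.
Variables (k : fieldType) (f : {rmorphism k -> U}).
Hypothesis f_small : small (range f).

Definition dterm_jet (j : nat) : dterm U 1 := iter j (@DDer U 1) (DVar U ord0).

Definition dterm_of n (P : {mpoly k[n]}) : dterm U 1 :=
  \big[@DAdd U 1/DCst 1 0]_(m <- msupp P)
    DMul (DCst 1 (f P@_m)) (\big[@DMul U 1/DCst 1 1]_(j < n)
      iter (m j) (DMul (dterm_jet j)) (DCst 1 1)).

Lemma deval_dterm_of n (P : {mpoly k[n]}) y :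
  deval delta [tuple y] (dterm_of P) = mpoly_eval f (jet y) n P.
Proof.
have jetE j : deval delta [tuple y] (dterm_jet j) = jet y j.
  by elim: j => //= j ->.
rewrite /dterm_of (big_morph (deval delta [tuple y]) (id1 := 0) (op1 := +%R)) //.
rewrite /= mmapEsupp; apply: eq_bigr => m _ /=; congr (_ * _).
rewrite (big_morph (deval delta [tuple y]) (id1 := 1) (op1 := *%R)) //.
apply: eq_bigr => j _; elim: (m j) => [|l IHl] /=; first by rewrite expr0.
by rewrite exprS IHl jetE.
Qed.

Lemma dterm_of_over (A : set U) n (P : {mpoly k[n]}) :
  range f `<=` A -> dterm_over A (dterm_of P).
Proof.
move=> fA; have A0 : A 0 by apply: fA; exists 0; rewrite ?rmorph0.
have A1 : A 1 by apply: fA; exists 1; rewrite ?rmorph1.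
rewrite /dterm_of; apply: (big_ind (@dterm_over U A 1)) => //= m _.
split; first by apply: fA; exists P@_m.
apply: (big_ind (@dterm_over U A 1)) => //= j _.
elim: (m j) => //= l IHl; split=> //.
by rewrite /dterm_jet; elim: (nat_of_ord j).
Qed.

(** Finitely many inequations Q amount to one, their product; with the equation P
    it is solvable by Blum's axioms, because P involves the last variable while Q
    has one variable less. *)
Lemma generic_root n (P : {mpoly k[n.+1]}) :
  (exists2 m, m \in msupp P & m ord_max != 0%N) ->
  exists2 y, mpoly_eval f (jet y) _ P = 0 &
    forall Q : {mpoly k[n]}, Q != 0 -> mpoly_eval f (jet y) n Q <> 0.
Proof.
move=> [m0 Pm0 m0max].
have [||||i j|[Q nQ]|y Ey Ny] := @compactness (range f) {Q : {mpoly k[n]} | Q != 0}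
  [set dterm_of P] (fun Q => dterm_of (sval Q)) f_small.
- by exists 0; rewrite ?rmorph0.
- by move=> _ ->; apply: dterm_of_over.
- by move=> i; apply: dterm_of_over.
- by exists; exists 1; apply: oner_neq0.
- exists (exist _ (sval i * sval j) (mulf_neq0 (svalP i) (svalP j))) => y /=.
  rewrite !deval_dterm_of rmorphM => /eqP; rewrite mulf_eq0 negb_or => /andP[].
  by move=> /eqP ? /eqP ?.
- have [||y [Py Qy]] := @DCF0_blum _ _ (universal_DCF0 HU) n
    (map_mpoly f P) (map_mpoly f Q).
  + by exists m0 => //; rewrite (perm_mem (msupp_map_mpoly _ _)) //; apply: fmorph_inj.
  + by apply: contra_neq nQ => Q0; apply/mpolyP=> m;
      apply: (fmorph_inj f); rewrite -mcoeff_map_mpoly Q0 !mcoeff0 rmorph0.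
  exists y => [_ ->|]; rewrite deval_dterm_of /= -meval_map_mpoly //.
  exact/eqP.
exists y; first by rewrite -deval_dterm_of; apply: Ey.
by move=> Q nQ; rewrite -deval_dterm_of; apply: (Ny (exist _ Q nQ)).
Qed.

(** Finitely many inequations are brought to the same number n of variables and
    multiplied together; Blum's axioms, with the equation [x^(n) = 0], solve the
    result. *)
Lemma generic_point :
  exists y, forall n (Q : {mpoly k[n]}), Q != 0 -> mpoly_eval f (jet y) n Q <> 0.
Proof.
have [||||[n [Q nQ]] [n' [Q' nQ']]|[n [Q nQ]]|y Ey Ny] :=
  @compactness (range f) {n & {Q : {mpoly k[n]} | Q != 0}}
  set0 (fun i => dterm_of (sval (tagged i))) f_small.
- by exists 0; rewrite ?rmorph0.
- by [].
- by move=> i; apply: dterm_of_over.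
- by exists; exists 0%N; exists 1; apply: oner_neq0.
- have [R [nR evR]] := mpoly_widen Q (leq_addr n' n).
  have [R' [nR' evR']] := mpoly_widen Q' (leq_addl n n').
  exists (existT _ (n + n')%N (exist _ (R * R') (mulf_neq0 (nR nQ) (nR' nQ')))) => y /=.
  rewrite !deval_dterm_of rmorphM evR evR' => /eqP.
  by rewrite mulf_eq0 negb_or => /andP[] /eqP ? /eqP ?.
- have [||y [_ Qy]] := @DCF0_blum _ _ (universal_DCF0 HU) n 'X_ord_max (map_mpoly f Q).
  + by exists U_(ord_max)%MM; rewrite ?msuppX ?mem_head // mnm1E eqxx.
  + by apply: contra_neq nQ => Q0; apply/mpolyP=> m;
      apply: (fmorph_inj f); rewrite -mcoeff_map_mpoly Q0 !mcoeff0 rmorph0.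
  by exists y => //; rewrite deval_dterm_of /= -meval_map_mpoly; apply/eqP.
by exists y => n Q nQ; rewrite -deval_dterm_of; apply: (Ny (existT _ n (exist _ Q nQ))).
Qed.

End Generic.
End Saturation.

(** * Extending isomorphisms of differential fields *)

(** When A is a domain and e is injective, F is up to a scalar the minimal
    polynomial of x over the fraction field of e(A). *)
Definition minimal_annihilator (A : nzRingType) (U : comNzRingType)
    (e : {rmorphism A -> U}) (x : U) (F : {poly A}) : Prop :=
  [/\ F != 0, poly_eval e x F = 0 &
      forall q, q != 0 -> poly_eval e x q = 0 -> (size F <= size q)%N].

Section MinimalAnnihilator.
Variables (A U : idomainType).

Lemma minimal_annihilator_exists (e : {rmorphism A -> U}) x F :
  F != 0 -> poly_eval e x F = 0 -> exists M, minimal_annihilator e x M.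
Proof.
move=> nF eF; have [|M [nM eM] minM] := @minimal_size A
  (fun q => q != 0 /\ poly_eval e x q = 0); first by exists F.
by exists M; split=> // q nq eq; apply: minM.
Qed.

(** By pseudo-division: the remainder vanishes at x and is too small to be
    nonzero. *)
Lemma minimal_annihilator_divides (e : {rmorphism A -> U}) x F p :
  minimal_annihilator e x F -> poly_eval e x p = 0 ->
  exists2 c, c != 0 & exists q, c *: p = q * F.
Proof.
move=> [nF eF minF] ep; exists (lead_coef F ^+ scalp p F).
  by rewrite expf_neq0 // lead_coef_eq0.
exists (p %/ F)%R; rewrite Pdiv.Idomain.divp_eq.
have [->|nr] := eqVneq (p %% F) 0; first by rewrite addr0.
have := minF _ nr; rewrite leqNgt Pdiv.Idomain.ltn_modp nF => /(_ _)/negP[] //.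
have := congr1 (poly_eval e x) (Pdiv.Idomain.divp_eq p F).
by rewrite rmorphD rmorphM eF mulr0 add0r -mul_polyC rmorphM ep mulr0.
Qed.

Lemma minimal_annihilator_sub (e1 e2 : {rmorphism A -> U}) x y F p :
  (forall a, a != 0 -> e2 a != 0) -> minimal_annihilator e1 x F ->
  poly_eval e2 y F = 0 -> poly_eval e1 x p = 0 -> poly_eval e2 y p = 0.
Proof.
move=> inj2 minF yF xp; have [c nc [q cp]] := minimal_annihilator_divides minF xp.
have /eqP := congr1 (poly_eval e2 y) cp.
rewrite rmorphM yF mulr0 -mul_polyC rmorphM poly_evalC mulf_eq0.
by rewrite (negPf (inj2 _ nc)) => /eqP.
Qed.

(** Let M have least degree for y, so that [c *: F = r * M].  At x, either r or M
    vanishes.  In the first case r has degree at least that of F, so M is a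
    nonzero constant and cannot vanish at y.  In the second case M has degree at
    least that of F. *)
Lemma minimal_annihilator_transfer (e1 e2 : {rmorphism A -> U}) x y F :
  (forall a, a != 0 -> e1 a != 0) -> (forall a, a != 0 -> e2 a != 0) ->
  minimal_annihilator e1 x F -> poly_eval e2 y F = 0 ->
  minimal_annihilator e2 y F.
Proof.
move=> inj1 inj2 minF yF; have [nF xF lF] := minF.
have [M minM] := minimal_annihilator_exists nF yF; have [nM yM lM] := minM.
split=> // q nq yq; apply: leq_trans (lM q nq yq).
have [c nc [r cF]] := minimal_annihilator_divides minM yF.
have nr : r != 0.
  by apply: contra_neq nF => r0; apply/eqP; move/eqP: cF; 
    rewrite r0 mul0r -mul_polyC mulf_eq0 polyC_eq0 (negPf nc).
have /eqP := congr1 (poly_eval e1 x) cF.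
rewrite -mul_polyC !rmorphM xF mulr0 eq_sym mulf_eq0 => /orP[/eqP xr|/eqP];
  last exact: lF.
have := congr1 (fun p : {poly A} => size p) cF; rewrite size_scale // size_mul // => szF.
have szr := lF _ nr xr; have M1 : (size M <= 1)%N.
  rewrite -(leq_add2l (size r)) addn1 -(prednK (_ : 0 < size r + size M)%N) -?szF //.
  by rewrite addn_gt0 size_poly_gt0 nr.
move: yM nM; rewrite (size1_polyC M1) poly_evalC polyC_eq0 => yM /inj2.
by rewrite yM eqxx.
Qed.

End MinimalAnnihilator.

Lemma dc_mpoly_eval (k : nzRingType) (R : comUnitRingType) (i : {rmorphism k -> R})
    (S : set R) z n (Q : {mpoly k[n]}) :
  divring_closed (mem S) -> range i `<=` S -> (forall j, (j < n)%N -> S (z j)) ->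
  S (mpoly_eval i z n Q).
Proof.
move=> hS iS Sz; rewrite /= mmapEsupp; apply: dc_sum => // m _; apply: dcM => //.
  by apply: iS; exists Q@_m.
by apply: dc_prod => // j _; apply: dcX => //; apply: Sz.
Qed.

Lemma countable_setU (T : Type) (S1 S2 : set T) :
  countable S1 -> countable S2 -> countable (S1 `|` S2).
Proof.
move=> c1 c2; have -> : S1 `|` S2 = \bigcup_(b in [set: bool]) (if b then S1 else S2).
  apply/seteqP; split=> [w [Sw|Sw]|w [[] _ Sw]]; by
    [exists true | exists false | left | right].
by apply: bigcup_countable => // -[].
Qed.

Section Graphs.
Variables (U : fieldType) (delta : {additive U -> U}).

Definition pair_delta (w : U * U) : U * U := (delta w.1, delta w.2).

Lemma pair_delta_is_zmod_morphism : zmod_morphism pair_delta.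
Proof. by move=> v w; rewrite /pair_delta !raddfB. Qed.

HB.instance Definition _ := GRing.isZmodMorphism.Build (U * U)%type (U * U)%type
  pair_delta pair_delta_is_zmod_morphism.

Lemma pair_unitE (w : U * U) : (w \is a GRing.unit) = (w.1 != 0) && (w.2 != 0).
Proof. by rewrite -!unitfE. Qed.

(** The graph of an isomorphism between two differential subfields of U. *)
Definition dgraph (G : set (U * U)) : Prop :=
  dclosed pair_delta G /\ gfield G.

Hypothesis HU : is_universal delta.
Let dM := DCF0_leibniz (universal_DCF0 HU).
Let U0 := DCF0_char (universal_DCF0 HU).

Lemma pair_deltaM v w : pair_delta (v * w) = pair_delta v * w + v * pair_delta w.
Proof. by rewrite /pair_delta /= !dM. Qed.

(** A subring of a graph that is stable under inversion and derivation is again a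
    graph, so one can pass to the part generated by countably many pairs. *)
Lemma countable_subgraph (H S : set (U * U)) :
  dgraph H -> countable S -> S `<=` H ->
  exists H0, [/\ dgraph H0, countable H0 & S `<=` H0].
Proof.
move=> [dH [_ uH]] cS SH; pose H0 := smallest (dclosed pair_delta) S.
have H0H : H0 `<=` H by apply: smallest_sub.
have [hH0 dH0] : dclosed pair_delta H0 := smallest_dclosed _ _.
exists H0; split; [|exact: countable_smallest|exact: sub_gen_smallest].
by split=> //; split=> // w /H0H; apply: uH.
Qed.

(** In this section [i] lists the graph of an isomorphism from the field [i1 k] to
    the field [i2 k].  A partner y is sought for x; the pair [z y j] consists of
    the j-th derivatives of x and y. *)
Section Extension.
Variables (k : fieldType) (i : {rmorphism k -> U * U}) (x : U).
Hypothesis i_delta : forall c, range i (pair_delta (i c)).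
Let i1 : {rmorphism k -> U} := fst \o i.
Let i2 : {rmorphism k -> U} := snd \o i.
Hypothesis i2_small : small (range i2).

Let z y j : U * U := (jet delta x j, jet delta y j).

Let z1 y n Q : (mpoly_eval i (z y) n Q).1 = mpoly_eval i1 (jet delta x) n Q.
Proof. exact: (mmap_comp i fst). Qed.

Let z2 y n Q : (mpoly_eval i (z y) n Q).2 = mpoly_eval i2 (jet delta y) n Q.
Proof. exact: (mmap_comp i snd). Qed.

(** Here y is chosen with all its derivatives independent.  The extended graph is
    the increasing union of the fields H n generated by the pairs of derivatives
    of order less than n; the derivation maps H n into H n.+1. *)
Lemma extend_graph_transcendental :
  (forall n (Q : {mpoly k[n]}), Q != 0 -> mpoly_eval i1 (jet delta x) n Q != 0) ->
  exists y H, [/\ dgraph H, range i `<=` H & H (x, y)].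
Proof.
move=> indep_x; have [y Hy] := generic_point HU i2_small.
have eP n (Q : {mpoly k[n]}) : mpoly_eval i (z y) n Q = 0 \/
    mpoly_eval i (z y) n Q \is a GRing.unit.
  have [->|nQ] := eqVneq Q 0; first by left; rewrite rmorph0.
  by right; rewrite pair_unitE z1 z2 indep_x //=; apply/eqP/Hy.
pose H n := fractions (mpoly_eval i (z y) n).
have hH n : divring_closed (mem (H n)) := (fractions_gfield (@eP n)).1.
have Hi n c : H n (i c).
  by rewrite -[i c](mmapC (fun j : 'I_n => z y j) i c); apply: fractionsI.
have Hz n j : (j < n)%N -> H n (z y j).
  move=> jn; have <- : mpoly_eval i (z y) n 'X_(Ordinal jn) = z y j.
    by rewrite /= mmapX mmap1U.
  exact: fractionsI.
have HS n N : (n <= N)%N -> H n `<=` H N.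
  move=> nN; apply: fractions_sub => // Q; have [Q' [_ <-]] := mpoly_widen Q nN.
  exact: fractionsI.
have HD n w : H n w -> H n.+1 (pair_delta w).
  move=> Hw; suff: H n `<=` [set w | H n.+1 w /\ H n.+1 (pair_delta w)].
    by move=> /(_ w Hw)[].
  have hT := closed_with_derivative pair_deltaM (hH n.+1).
  apply: fractions_sub => // Q; apply: dc_mpoly_eval => // [_ [c _ <-]|j jn].
    by split=> //; have [c' _ <-] := i_delta c.
  by split; [apply: Hz; apply: leqW | apply: (Hz n.+1 j.+1)].
have hU : divring_closed (mem (\bigcup_n H n)).
  apply: divring_closedI => [|v w [n _ Hv] [n' _ Hw]|v w [n _ Hv] [n' _ Hw]].
  - by exists 0%N => //; apply: (dc1 (hH 0%N)).
  - exists (maxn n n') => //; apply: (dcB (hH _)).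
      by apply: HS Hv; apply: leq_maxl.
    by apply: HS Hw; apply: leq_maxr.
  - exists (maxn n n') => //; apply: (dc_div (hH _)).
      by apply: HS Hv; apply: leq_maxl.
    by apply: HS Hw; apply: leq_maxr.
exists y, (\bigcup_n H n); split.
- split; split=> // w [n _ Hw]; first by exists n.+1 => //; apply: HD.
  exact: (fractions_gfield (@eP n)).2.
- by move=> _ [c _ <-]; exists 0%N.
- by exists 1%N => //; apply: (Hz 1%N 0%N).
Qed.

(** The extended graph is generated by the pairs of derivatives of order at most
    n, the order of x.  A polynomial over k in X_0, ..., X_n vanishes at the jet
    of x if and only if it vanishes at the jet of y, both sides having the same
    minimal annihilator F.  The next pair of derivatives already belongs to the
    field, by differentiating F. *)
Lemma extend_graph_algebraic :
  (exists n (Q : {mpoly k[n]}), Q != 0 /\ mpoly_eval i1 (jet delta x) n Q = 0) ->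
  exists y H, [/\ dgraph H, range i `<=` H & H (x, y)].
Proof.
move=> dep_x; have exn : exists n, `[< exists Q : {mpoly k[n]}, Q != 0 /\
    mpoly_eval i1 (jet delta x) n Q = 0 >].
  by have [n Qn] := dep_x; exists n; apply/asboolP.
(* The least n for which x, ..., x^(n) are dependent is the order of x. *)
case: (ex_minnP exn) => [] [|n] /asboolP[P [nP xP]] min_n.
  move: nP xP; rewrite (mpoly0_const P) /= mmapC mpolyC_eq0 => nc /eqP.
  by rewrite fmorph_eq0 (negPf nc).
have inj1 (Q : {mpoly k[n]}) : Q != 0 -> mpoly_eval i1 (jet delta x) n Q != 0.
  move=> nQ; apply/eqP => xQ; have := min_n n; rewrite ltnn => /(_ _)/notF; apply.
  by apply/asboolP; exists Q.
have [||F minF] := @minimal_annihilator_exists {mpoly k[n]} U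
    (mpoly_eval i1 (jet delta x) n) (jet delta x n) (muni P).
- by apply: contra_neq nP => /muni_eq0.
- by rewrite -xP /= mmap_muni.
have [nF xF lF] := minF.
have sF : (1 < size F)%N.
  rewrite ltnNge; apply/negP => s1; move: nF xF.
  rewrite (size1_polyC s1) poly_evalC polyC_eq0 => /inj1 /[swap] ->.
  by rewrite eqxx.
have [y yF Hy] := generic_root HU i2_small (mmulti_last_variable sF).
have {}yF : poly_eval (mpoly_eval i2 (jet delta y) n) (jet delta y n) F = 0.
  by rewrite -yF /= mmap_mmulti.
have inj2 (Q : {mpoly k[n]}) : Q != 0 -> mpoly_eval i2 (jet delta y) n Q != 0.
  by move=> /Hy/eqP.
have minF2 := minimal_annihilator_transfer inj1 inj2 minF yF.
pose e := poly_eval (mpoly_eval i (z y) n) (z y n).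
have e1 p : (e p).1 = poly_eval (mpoly_eval i1 (jet delta x) n) (jet delta x n) p.
  rewrite /e /= /horner_eval -(horner_map fst) -map_poly_comp /=.
  by congr (_.[_]); apply: eq_map_poly => Q; apply: z1.
have e2 p : (e p).2 = poly_eval (mpoly_eval i2 (jet delta y) n) (jet delta y n) p.
  rewrite /e /= /horner_eval -(horner_map snd) -map_poly_comp /=.
  by congr (_.[_]); apply: eq_map_poly => Q; apply: z2.
have eP p : e p = 0 \/ e p \is a GRing.unit.
  have [xp|xp] := eqVneq (e p).1 0.
    left; apply/eqP; rewrite -pair_eqE /= xp eqxx /= e2; apply/eqP.
    by apply: (minimal_annihilator_sub inj2 minF yF); rewrite -e1.
  right; rewrite pair_unitE xp /= e2; apply/eqP => yp; move/eqP: xp; apply.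
  by rewrite e1; apply: (minimal_annihilator_sub inj1 minF2 xF).
have [hH uH] := fractions_gfield eP.
have Hi c : fractions e (i c).
  rewrite -[i c](mmapC (fun j : 'I_n => z y j) i c).
  by rewrite -[mmap _ _ _](poly_evalC (mpoly_eval i (z y) n) (z y n)); apply: fractionsI.
have Hz j : (j <= n)%N -> fractions e (z y j).
  rewrite leq_eqVlt => /orP[/eqP ->|jn].
    by rewrite -[z y n](poly_evalX (mpoly_eval i (z y) n)); apply: fractionsI.
  have <- : e ('X_(Ordinal jn))%:P = z y j.
    by rewrite /e poly_evalC /= mmapX mmap1U.
  exact: fractionsI.
have hT := closed_with_derivative pair_deltaM hH.
have Ti c : fractions e (i c) /\ fractions e (pair_delta (i c)).
  by split=> //; have [c' _ <-] := i_delta c.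
have TQ (Q : {mpoly k[n]}) : fractions e (mpoly_eval i (z y) n Q) /\
    fractions e (pair_delta (mpoly_eval i (z y) n Q)).
  apply: (dc_mpoly_eval _ hT) => [_ [c _ <-]|j jn]; first exact: Ti.
  by split; [apply: Hz; apply: ltnW | apply: (Hz j.+1)].
have HDz : fractions e (pair_delta (z y n)).
  apply: (D_root pair_deltaM hH (p := map_poly (mpoly_eval i (z y) n) F)).
  - by move=> j; rewrite coef_map; apply: (TQ _).1.
  - by move=> j; rewrite coef_map; apply: (TQ _).2.
  - exact: Hz.
  - by have [//|] := eP F; rewrite pair_unitE e1 xF eqxx.
  - rewrite deriv_map -/(horner_eval _ _); have [eF'|//] := eP F^`().
    have charA : [pchar {mpoly k[n]}] =i pred0.
      apply/pcharf0P => m; apply/idP/idP => [/eqP m0|/eqP->]; last by rewrite eqxx.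
      have := rmorph_nat (mpoly_eval i1 (jet delta x) n) m.
      by rewrite m0 rmorph0 => /esym/eqP; move/pcharf0P: U0 => ->.
    have := lt_size_deriv nF; rewrite ltnNge lF ?deriv_neq0 //.
    by rewrite -e1 eF'.
exists y, (fractions e); split.
- split; last by split.
  apply: (dclosed_fractions pair_deltaM eP) => p.
  suff [] : [set w | fractions e w /\ fractions e (pair_delta w)] (e p) by [].
  apply: (dc_horner hT) => [j|]; first by rewrite coef_map; apply: TQ.
  by split=> //; apply: Hz.
- by move=> _ [c _ <-].
- exact: (Hz 0%N).
Qed.

End Extension.

Lemma extend_graph (G : set (U * U)) (x : U) : dgraph G -> countable G ->
  exists y H, [/\ dgraph H, countable H, G `<=` H & H (x, y)].
Proof.
move=> [[hG dG] gG] cG; have [k [i GE]] := gfield_embedding gG.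
have i_delta c : range i (pair_delta (i c)).
  by rewrite -GE; apply: dG; rewrite GE; exists c.
have i2_small : small (range (snd \o i)).
  apply: (countable_small HU); apply: sub_countable cG.
  rewrite (_ : range (snd \o i) = snd @` G) ?card_image_le // GE.
  by apply/seteqP; split=> [_ [c _ <-]|_ [_ [c _ <-] <-]]; [exists (i c) | exists c].
have [y [H [dH GH Hxy]]] :
    exists y H, [/\ dgraph H, range i `<=` H & H (x, y)].
  have [alg|transc] := pselect (exists n (Q : {mpoly k[n]}), Q != 0 /\
    mpoly_eval (fst \o i) (jet delta x) n Q = 0).
    exact: extend_graph_algebraic.
  apply: extend_graph_transcendental => // n Q nQ.
  by apply/eqP => xQ; apply: transc; exists n, Q.
have [|w [Gw|->] //|H0 [dH0 cH0 sH0]] := @countable_subgraph H (G `|` [set (x, y)]) dH.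
- by apply: countable_setU => //; apply: countable1.
- by apply: GH; rewrite -GE.
- exists y, H0; split=> //; first by move=> w Gw; apply: sH0; left.
  by apply: sH0; right.
Qed.

End Graphs.

(** * Isomorphisms preserve formulas *)

Section Coefficients.
Variable U : Type.

Lemma dterm_overS (A B : set U) m (t : dterm U m) :
  A `<=` B -> dterm_over A t -> dterm_over B t.
Proof. by move=> AB; elim: t => //= t1 IH1 t2 IH2 []; split; auto. Qed.

Lemma dformula_overS (A B : set U) m (phi : dformula U m) :
  A `<=` B -> dformula_over A phi -> dformula_over B phi.
Proof.
move=> AB; elim: phi => //= [{}m t1 t2 []|{}m p1 IH1 p2 IH2 []]; split; auto.
- exact: dterm_overS AB _.
- exact: dterm_overS AB _.
Qed.

End Coefficients.

Section FiniteCoefficients.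
Variable U : eqType.

Lemma seq_cat_subset (A : set U) (s1 s2 : seq U) :
  [set` s1] `<=` A -> [set` s2] `<=` A ->
  [/\ [set` s1 ++ s2] `<=` A, [set` s1] `<=` [set` s1 ++ s2] &
      [set` s2] `<=` [set` s1 ++ s2]].
Proof.
move=> A1 A2; split=> x /=; rewrite mem_cat.
- by case/orP => [/A1|/A2].
- by move=> ->.
- by move=> ->; rewrite orbT.
Qed.

Lemma dterm_finite_support (A : set U) m (t : dterm U m) : dterm_over A t ->
  exists2 s : seq U, [set` s] `<=` A & dterm_over [set` s] t.
Proof.
elim: t => [j _|a Aa|t1 IH1 t2 IH2 [/IH1[s1 A1 o1] /IH2[s2 A2 o2]]|t IH /IH //
  |t1 IH1 t2 IH2 [/IH1[s1 A1 o1] /IH2[s2 A2 o2]]|t IH /IH //].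
- by exists [::].
- by exists [:: a] => [x /=|/=]; rewrite inE // => /eqP ->.
- have [A12 s12 s21] := seq_cat_subset A1 A2.
  by exists (s1 ++ s2) => //; split; [apply: dterm_overS o1 | apply: dterm_overS o2].
- have [A12 s12 s21] := seq_cat_subset A1 A2.
  by exists (s1 ++ s2) => //; split; [apply: dterm_overS o1 | apply: dterm_overS o2].
Qed.

Lemma dformula_finite_support (A : set U) m (phi : dformula U m) :
  dformula_over A phi ->
  exists2 s : seq U, [set` s] `<=` A & dformula_over [set` s] phi.
Proof.
elim: phi => [{}m t1 t2 [/dterm_finite_support[s1 A1 o1]
  /dterm_finite_support[s2 A2 o2]]|{}m p IH /IH //
  |{}m p1 IH1 p2 IH2 [/IH1[s1 A1 o1] /IH2[s2 A2 o2]]|{}m p IH /IH //].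
- have [A12 s12 s21] := seq_cat_subset A1 A2.
  by exists (s1 ++ s2) => //; split; [apply: dterm_overS o1 | apply: dterm_overS o2].
- have [A12 s12 s21] := seq_cat_subset A1 A2.
  exists (s1 ++ s2) => //.
  by split; [apply: dformula_overS o1 | apply: dformula_overS o2].
Qed.

End FiniteCoefficients.

Section Types.
Variables (U : fieldType) (delta : {additive U -> U}).
Hypothesis HU : is_universal delta.
Local Notation dgraph := (dgraph delta).

Lemma dgraph_zero (G : set (U * U)) u v : dgraph G -> G (u, v) -> u = 0 <-> v = 0.
Proof.
move=> [_ [_ uG]] Guv; have [[-> ->] //|nuv] := eqVneq (u, v) 0.
have := uG _ Guv nuv; rewrite pair_unitE /= => /andP[nu nv].
by split=> [u0|v0]; [move: nu; rewrite u0 eqxx | move: nv; rewrite v0 eqxx].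
Qed.

Lemma dgraph_swap (G : set (U * U)) : dgraph G -> dgraph [set w | G (w.2, w.1)].
Proof.
have swap_inv (w : U * U) : (w^-1).2 = (w.2, w.1)^-1.1 /\ (w^-1).1 = (w.2, w.1)^-1.2.
  have invE (v : U * U) : v^-1 = if v \is a GRing.unit then (v.1^-1, v.2^-1) else v by [].
  by rewrite !invE !pair_unitE andbC; case: ifP.
move=> [[hG dG] [_ uG]].
have h : divring_closed (mem [set w | G (w.2, w.1)]).
  apply: divring_closedI => [|v w|v w] /=; first exact: (dc1 hG).
  - exact: (dcB hG).
  - move=> Gv Gw; have := dc_div hG Gv Gw.
    suff -> : (v.2, v.1) / (w.2, w.1) = ((v / w).2, (v / w).1) by [].
    by rewrite /= [(w^-1).2](swap_inv w).1 [(w^-1).1](swap_inv w).2.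
split; split=> // w; first by move/dG.
move=> /uG Gw nw; have := Gw; rewrite !pair_unitE andbC; apply.
by apply: contra_neq nw; case: w {Gw} => u v [-> ->].
Qed.

Lemma dgraph_deval (G : set (U * U)) m (e1 e2 : m.-tuple U) (A : set U) t :
  dgraph G -> (forall j, G (tnth e1 j, tnth e2 j)) -> (forall a, A a -> G (a, a)) ->
  dterm_over A t -> G (deval delta e1 t, deval delta e2 t).
Proof.
move=> [[hG dG] _] Ge GA; elim: t => //=.
- by move=> t1 IH1 t2 IH2 [/IH1 G1 /IH2 G2]; exact: (dcD hG G1 G2).
- by move=> t IH /IH G1; exact: (dcN hG G1).
- by move=> t1 IH1 t2 IH2 [/IH1 G1 /IH2 G2]; exact: (dcM hG G1 G2).
- by move=> t IH /IH /dG.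
Qed.

(** The quantifier is the only step with content: a witness on one side is
    matched on the other side by extending the graph, or the inverse graph. *)
Lemma dgraph_elementary m (phi : dformula U m) (G : set (U * U))
    (e1 e2 : m.-tuple U) (A : set U) :
  dgraph G -> countable G -> (forall j, G (tnth e1 j, tnth e2 j)) ->
  (forall a, A a -> G (a, a)) -> dformula_over A phi ->
  dholds delta e1 phi <-> dholds delta e2 phi.
Proof.
elim: phi G e1 e2 => [{}m t1 t2|{}m psi IH|{}m p1 IH1 p2 IH2|{}m psi IH] G e1 e2
  dG cG Ge GA /=.
- move=> [o1 o2].
  have G12 := dcB dG.1.1 (dgraph_deval dG Ge GA o1) (dgraph_deval dG Ge GA o2).
  have [z1 z2] := dgraph_zero dG G12; split=> /eqP; rewrite -subr_eq0 => /eqP.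
    by move=> /z1/eqP; rewrite subr_eq0 => /eqP.
  by move=> /z2/eqP; rewrite subr_eq0 => /eqP.
- by move=> /(IH _ _ _ dG cG Ge GA) ->.
- by move=> [/(IH1 _ _ _ dG cG Ge GA) -> /(IH2 _ _ _ dG cG Ge GA) ->].
- have forth (G' : set (U * U)) (a1 a2 : m.-tuple U) : dgraph G' -> countable G' ->
      (forall j, G' (tnth a1 j, tnth a2 j)) -> (forall a, A a -> G' (a, a)) ->
      dformula_over A psi -> dholds delta a1 (DEx psi) -> dholds delta a2 (DEx psi).
    move=> dG' cG' Ga GA' opsi [x Hx].
    have [y [H [dH cH GH Hxy]]] := extend_graph HU x dG' cG'.
    exists y; apply/(IH H [tuple of x :: a1] [tuple of y :: a2]) => //.
      by move=> j; case: (unliftP ord0 j) => [l|] ->; rewrite ?tnthS ?tnth0 //; apply/GH.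
    by move=> a /GA'/GH.
  move=> opsi; split; first exact: (forth G).
  apply: (forth [set w | G (w.2, w.1)]) => //; first exact: dgraph_swap.
  have -> : [set w | G (w.2, w.1)] = (fun w : U * U => (w.2, w.1)) @` G.
    by apply/seteqP; split=> [[u v] Gvu|_ [[u v] Guv <-]] //; exists (v, u).
  apply: (sub_countable (card_image_le _ _)) cG.
Qed.

End Types.

(** * Stationarity and internality of Liouvillian steps *)

Section AffineSteps.
Variables (U : fieldType) (delta : {additive U -> U}).
Hypothesis HU : is_universal delta.
Let dM := DCF0_leibniz (universal_DCF0 HU).
Let U0 := DCF0_char (universal_DCF0 HU).
Implicit Types (K L A : set U).

Lemma countable_gen_dfield L (S : set U) :
  countable L -> countable S -> countable (gen_dfield delta L S).
Proof. by move=> cL cS; apply/countable_smallest/countable_setU. Qed.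

Lemma countable_seq (s : seq U) : countable [set` s].
Proof. exact/finite_set_countable/finite_seq. Qed.

Lemma diagonal_gfield A : is_subfield A -> gfield [set (a, a) | a in A].
Proof.
move=> hA; split; last first.
  by move=> _ [a _ <-] na; rewrite pair_unitE /= andbb; apply: contra_neq na => ->.
apply: divring_closedI; first by exists 1; first exact: (dc1 hA).
- by move=> _ _ [a Aa <-] [b Ab <-]; exists (a - b); first exact: (dcB hA).
- move=> _ _ [a Aa <-] [b Ab <-]; exists (a / b); first exact: (dc_div hA).
  have [->|nb] := eqVneq b 0; first by rewrite !invr0 !mulr0.
  apply: (@mulIr _ (b, b)); first by rewrite pair_unitE /= nb.
  rewrite divrK; last by rewrite pair_unitE /= nb.
  by rewrite -[LHS]/(a / b * b, a / b * b) divfK.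
Qed.

(** Both x and y are transcendental over A, so A(x) and A(y) are isomorphic as
    fields over A.  The isomorphism respects the derivation, because [b * x + a]
    and [b * y + a] are given by the same formula.  The two kinds of steps
    [delta x = a] and [delta x = b * x] are the cases b = 0 and a = 0. *)
Lemma affine_generic_graph A a b x y : is_dfield delta A -> countable A ->
  A a -> A b -> delta x = b * x + a -> delta y = b * y + a ->
  ~ alg_closure A x -> ~ alg_closure A y ->
  exists H, [/\ dgraph delta H, countable H, forall c, A c -> H (c, c) & H (x, y)].
Proof.
move=> [hA dA] cA Aa Ab dx dy nx ny.
have [k [i GE]] := gfield_embedding (diagonal_gfield hA).
pose i1 : {rmorphism k -> U} := fst \o i.
pose i2 : {rmorphism k -> U} := snd \o i.
have iA c : A (i c).1 /\ i c = ((i c).1, (i c).1).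
  have : range i (i c) by exists c.
  by rewrite -GE => -[u Au <-].
have A1 : A = range i1.
  apply/seteqP; split=> [u Au|_ [c _ <-]]; last exact: (iA c).1.
  have : [set (u, u) | u in A] (u, u) by exists u.
  by rewrite GE => -[c _ ic]; exists c => //=; rewrite ic.
have i12 : i2 =1 i1 by move=> c /=; rewrite (iA c).2.
pose e := poly_eval i (x, y).
have e1 p : (e p).1 = poly_eval i1 x p.
  by rewrite /e /= /horner_eval -(horner_map fst) -map_poly_comp.
have e2 p : (e p).2 = poly_eval i1 y p.
  rewrite /e /= /horner_eval -(horner_map snd) -map_poly_comp.
  by congr (_.[_]); apply: eq_map_poly => c; apply: i12.
have transc u p : ~ alg_closure A u -> p != 0 -> poly_eval i1 u p != 0.
  move=> nu np; apply/eqP => pu; apply: nu; rewrite A1; apply/alg_closureP.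
  by exists p => //; apply/rootP.
have eP p : e p = 0 \/ e p \is a GRing.unit.
  have [->|np] := eqVneq p 0; first by left; rewrite rmorph0.
  by right; rewrite pair_unitE e1 e2 !transc.
have [hH uH] := fractions_gfield eP.
have Hi c : fractions e (i c) by rewrite -(poly_evalC i (x, y)); apply: fractionsI.
have HA u : A u -> fractions e (u, u).
  by rewrite A1 => -[c _ <-]; have := Hi c; rewrite (iA c).2.
have Hxy : fractions e (x, y) by rewrite -(poly_evalX i (x, y)); apply: fractionsI.
have hT := closed_with_derivative (pair_deltaM HU) hH.
have dH : dgraph delta (fractions e).
  split; last by split.
  apply: (dclosed_fractions (pair_deltaM HU) eP) => p.
  suff [] : [set w | fractions e w /\ fractions e (pair_delta delta w)] (e p) by [].
  apply: (dc_horner hT) => [j|].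
    rewrite coef_map; split; first exact: Hi.
    by rewrite /= (iA p`_j).2; apply: HA; apply: dA; apply: (iA _).1.
  split=> //=.
  have -> : pair_delta delta (x, y) = (b, b) * (x, y) + (a, a) :> U * U.
    by rewrite /pair_delta /= dx dy.
  by apply: (dcD hH); [apply: (dcM hH) => // | ]; apply: HA.
have [|w [[u Au <-]|->]|H0 [dH0 cH0 sH0]] :=
  @countable_subgraph _ _ _ ([set (c, c) | c in A] `|` [set (x, y)]) dH.
- apply: countable_setU; last exact: countable1.
  exact: (sub_countable (card_image_le _ _)) cA.
- exact: HA.
- by [].
- exists H0; split=> // [c Ac|]; apply: sH0; [left; by exists c | by right].
Qed.

(** The equation of x, and each inequation saying that x is not a root of a given
    polynomial, are formulas over L. *)
Lemma tp_affine_transcendental L a b x (y : 1.-tuple U) : is_dfield delta L ->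
  L a -> L b -> delta x = b * x + a -> ~ alg_closure L x ->
  tp delta L [tuple x] `<=` tp delta (alg_closure L) y ->
  delta (tnth y ord0) = b * tnth y ord0 + a /\ ~ alg_closure L (tnth y ord0).
Proof.
move=> [hL dL] La Lb dx nx; rewrite (tuple1E y); move: (tnth y ord0) => {}y sub.
rewrite tnth0; split.
  pose v0 := DVar U (ord0 : 'I_1).
  have /sub[_ //] : tp delta L [tuple x]
    (DEq (DDer v0) (DAdd (DMul (DCst 1 b) v0) (DCst 1 a))) by split=> //=.
have [k [i LE]] := subfield_embedding hL; rewrite LE => /alg_closureP[p np /rootP py].
have [P [_ evP]] := poly_as_mpoly p.
have /sub[_] : tp delta L [tuple x] (DNot (DEq (dterm_of i P) (DCst 1 0))).
  split.
    by split; [apply: dterm_of_over; rewrite LE | apply: (dc0 hL)].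
  rewrite /= deval_dterm_of evP /= => px; apply: nx; rewrite LE; apply/alg_closureP.
  by exists p => //; apply/rootP.
by rewrite /= deval_dterm_of evP; apply.
Qed.

(** A formula over L^alg has finitely many parameters, which generate over L a
    countable differential field A contained in L^alg; the solutions x and y,
    being transcendental over L, are transcendental over A. *)
Lemma affine_stationary L a b x : is_dfield delta L -> countable L ->
  L a -> L b -> delta x = b * x + a -> ~ alg_closure L x ->
  stationary delta L (tp delta L [tuple x]).
Proof.
move=> dL cL La Lb dx nx; have hL := dL.1; have LA := sub_alg_closure hL.
exists (tp delta (alg_closure L) [tuple x]); split.
  split; first by exists [tuple x].
  by move=> phi [Lphi xphi]; split=> //; apply: dformula_overS Lphi.
move=> _ [[y ->] sub]; have [dy ny] := tp_affine_transcendental dL La Lb dx nx sub.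
rewrite (tuple1E y); move: (tnth y ord0) dy ny => {sub}y dy ny.
apply/seteqP; suff equiv (phi : dformula U 1) : dformula_over (alg_closure L) phi ->
    dholds delta [tuple x] phi <-> dholds delta [tuple y] phi.
  by split=> phi [ophi Hphi]; split=> //; apply/equiv.
move=> /dformula_finite_support[s As os].
pose A := gen_dfield delta L [set` s].
have AL : A `<=` alg_closure L.
  by apply: gen_dfield_min => //; apply: alg_closure_dfield.
have nA u : ~ alg_closure L u -> ~ alg_closure A u.
  by move=> nu /(alg_closureS AL)/(alg_closure_idem hL).
have LsubA : L `<=` A by move=> u Lu; apply: gen_dfieldP; left.
have [||||||||H [dH cH HA Hxy]] := @affine_generic_graph A a b x y => //.
- exact: gen_dfield_dfield.
- by apply: countable_gen_dfield => //; apply: countable_seq.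
- exact: LsubA.
- exact: LsubA.
- exact: nA.
- exact: nA.
apply: (dgraph_elementary HU dH cH _ HA); first by move=> j; rewrite (ord1 j) !tnth0.
by apply: dformula_overS os => u su; apply: gen_dfieldP; right.
Qed.

(** Over F = L<x>, another realization is [x + c] or [c * x] for a constant c. *)
Lemma liouville_step_internal L x : is_dfield delta L -> countable L ->
  L (delta x) \/ L (delta x / x) -> ~ alg_closure L x ->
  internal delta L (tp delta L [tuple x]).
Proof.
move=> dL cL Lx nx; have hL := dL.1.
have x0 : x != 0.
  by apply/eqP => x0; apply: nx; rewrite x0; apply: sub_alg_closure => //; apply: dc0.
pose F := gen_dfield delta L [set x].
have Fx : F x by apply: gen_dfieldP; right.
pose v := DVar U (ord0 : 'I_1).
exists F; split.
- exact: gen_dfield_dfield.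
- by apply: (countable_small HU); apply: countable_gen_dfield => //; apply: countable1.
- by move=> u Lu; apply: gen_dfieldP; left.
move=> y; rewrite (tuple1E y); move: (tnth y ord0) => {}y typ.
have genF c u : F u -> gen_field F [set` [:: c]] u.
  by move=> Fu; apply: gen_fieldP; left.
have genc c : gen_field F [set` [:: c]] c.
  by apply: gen_fieldP; right; rewrite /= mem_head.
have hF c : divring_closed (mem (gen_field F [set` [:: c]])) := gen_field_subfield _ _.
case: Lx => Lx.
- have : tp delta L [tuple x] (DEq (DDer v) (DCst 1 (delta x))) by [].
  rewrite -typ => -[_ /= dy]; exists [:: y - x]; split.
    by move=> c /=; rewrite inE => /eqP ->; rewrite /constants /= raddfB dy subrr.
  move=> u /=; rewrite inE => /eqP ->; rewrite -[X in gen_field _ _ X](subrK x y).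
  by apply: (dcD (hF _)); [apply: genc | apply: genF].
- have : tp delta L [tuple x] (DEq (DDer v) (DMul (DCst 1 (delta x / x)) v)).
    by split=> //=; rewrite divfK.
  rewrite -typ => -[_ /=]; rewrite tnth0 => dy; exists [:: y / x]; split.
    move=> c /=; rewrite inE => /eqP ->; rewrite /constants /= dM (DV dM) ?unitfE //.
    by rewrite dy; field.
  move=> u /=; rewrite inE => /eqP ->; rewrite -[X in gen_field _ _ X](divfK x0 y).
  by apply: (dcM (hF _)); [apply: genc | apply: genF].
Qed.

End AffineSteps.

(** * Liouvillian towers *)

Section Liouville.
Variables (U : fieldType) (delta : {additive U -> U}).
Hypothesis HU : is_universal delta.
Let dM := DCF0_leibniz (universal_DCF0 HU).
Let U0 := DCF0_char (universal_DCF0 HU).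
Implicit Types (K L F : set U).

Definition liouville_step L (x : U) : Prop :=
  [\/ L (delta x), L (delta x / x) | alg_closure L x].

Definition liouville_chain K (s : seq U) : Prop :=
  forall i, (i < size s)%N -> liouville_step (gen_dfield delta K [set` take i s]) s`_i.

Lemma liouville_stepS L F x : L `<=` F -> liouville_step L x -> liouville_step F x.
Proof.
by move=> LF [/LF|/LF|/(alg_closureS LF)]; [apply: Or31|apply: Or32|apply: Or33].
Qed.

Lemma gen_dfieldS K (S T : set U) : S `<=` T ->
  gen_dfield delta K S `<=` gen_dfield delta K T.
Proof.
move=> ST; apply: gen_dfield_min; first exact: gen_dfield_dfield.
  by move=> x Kx; apply: gen_dfieldP; left.
by move=> x /ST Tx; apply: gen_dfieldP; right.
Qed.

(** The field below a step may be enlarged, so that towers over K can be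
    stacked. *)
Lemma liouville_chain_cat K s t :
  liouville_chain K s -> liouville_chain K t -> liouville_chain K (s ++ t).
Proof.
move=> cs ct i; rewrite size_cat nth_cat take_cat => it.
case: ltnP => si; first exact: cs.
have it' : (i - size s < size t)%N by rewrite ltn_subLR.
apply: liouville_stepS (ct _ it'); apply: gen_dfieldS => x /=.
by rewrite mem_cat orbC => ->.
Qed.

Lemma liouville_chain_rcons K s a : liouville_chain K s ->
  liouville_step (gen_dfield delta K [set` s]) a -> liouville_chain K (rcons s a).
Proof.
move=> cs sa i; rewrite size_rcons ltnS leq_eqVlt => /orP[/eqP ->|si].
  by rewrite nth_rcons ltnn eqxx -cats1 take_size_cat.
by rewrite nth_rcons si -cats1 takel_cat ?(ltnW si) //; apply: cs.
Qed.

Lemma liouvillian_chain K x : is_dfield delta K -> liouvillian delta K x ->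
  exists2 s, liouville_chain K s & gen_dfield delta K [set` s] x.
Proof.
move=> dK [m [F [F0 dF stepF Fx]]].
suff [s cs Fs] : exists2 s, liouville_chain K s & F m `<=` gen_dfield delta K [set` s].
  by exists s => //; apply: Fs.
move: (leqnn m); elim: {-2}m => [_|j IHj jm].
  by exists [::] => // u; rewrite F0 => Ku; apply: gen_dfieldP; left.
have [s cs Fs] := IHj (ltnW jm); have [a FE stepa] := stepF j jm.
exists (rcons s a); first exact: liouville_chain_rcons (liouville_stepS Fs stepa).
rewrite FE; apply: smallest_sub; first exact: (gen_dfield_dfield _ _ _).1.
move=> u [/Fs|->]; last by apply: gen_dfieldP; right; rewrite /= mem_rcons mem_head.
by apply: gen_dfieldS => v /= vs; rewrite mem_rcons inE vs orbT.
Qed.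

Lemma liouvillian_tuple_chain K m (y : m.-tuple U) : is_dfield delta K ->
  liouvillian_tuple delta K y ->
  exists2 s, liouville_chain K s & [set` y] `<=` gen_dfield delta K [set` s].
Proof.
move=> dK; rewrite /liouvillian_tuple; have -> : [set` y] = [set` tval y] by [].
elim: (tval y) => [_|x r IHr Hr]; first by exists [::].
have [|s cs rs] := IHr; first by move=> u /= ur; apply: Hr; rewrite /= inE ur orbT.
have [|t ct xt] := @liouvillian_chain K x dK; first by apply: Hr; rewrite /= mem_head.
exists (s ++ t); first exact: liouville_chain_cat.
move=> u /=; rewrite inE => /orP[/eqP ->|/rs].
  by move: xt; apply: gen_dfieldS => v /= vt; rewrite mem_cat vt orbT.
by apply: gen_dfieldS => v /= vs; rewrite mem_cat vs.
Qed.

Lemma chain_analyzable K m (y : m.-tuple U) s : is_dfield delta K -> countable K ->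
  liouville_chain K s -> [set` y] `<=` gen_dfield delta K [set` s] ->
  analyzable delta K y.
Proof.
move=> dK cK cs ys; exists s; split.
  by move=> u /ys; apply: sub_alg_closure; apply: (gen_dfield_dfield _ _ _).1.
move=> i si L; have := cs i si; rewrite -/L => step.
have dL : is_dfield delta L by apply: gen_dfield_dfield.
have cL : countable L by apply: countable_gen_dfield => //; apply: countable_seq.
have [|nx] := pselect (alg_closure L s`_i); [by left | right].
have Ldx : L (delta s`_i) \/ L (delta s`_i / s`_i) by case: step => //; [left | right].
split; last exact: liouville_step_internal.
have L0 : L 0 := dc0 dL.1.
case: Ldx => Lx.
  by apply: (affine_stationary HU dL cL Lx L0) => //; rewrite mul0r add0r.
apply: (affine_stationary HU dL cL L0 Lx) => //; rewrite addr0 divfK //.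
by apply/eqP => x0; apply: nx; rewrite x0; apply: sub_alg_closure => //; apply: dL.1.
Qed.

(** A generic root of the differential polynomial [X_1], that is, a generic
    solution of [delta c = 0]. *)
Lemma transcendental_constant M : is_dfield delta M -> countable M ->
  exists2 c, constants delta c & ~ alg_closure M c.
Proof.
move=> [hM _] cM; have [k [i ME]] := subfield_embedding hM.
have sM : small (range i) by rewrite -ME; apply: (countable_small HU).
have [|c dc nc] := generic_root HU sM (P := 'X_(ord_max : 'I_2)).
  by exists U_(ord_max)%MM; rewrite ?msuppX ?mem_head // mnm1E eqxx.
exists c; first by move: dc; rewrite /= mmapX mmap1U.
rewrite ME => /alg_closureP[p np /rootP pc].
by have [P [nP evP]] := poly_as_mpoly p; apply: (nc P (nP np)); rewrite evP.
Qed.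

Lemma gen_field_dfield L x : is_dfield delta L -> gen_field L [set x] (delta x) ->
  is_dfield delta (gen_field L [set x]).
Proof.
move=> [hL dL] Lx; have hG := gen_field_subfield L [set x].
split=> // u Gu; suff: gen_field L [set x] `<=`
    [set w | gen_field L [set x] w /\ gen_field L [set x] (delta w)].
  by move=> /(_ u Gu)[].
apply: smallest_sub; first exact: (closed_with_derivative dM hG).
have LG : L `<=` gen_field L [set x] by move=> v Lv; apply: gen_fieldP; left.
move=> v [Lv|->]; first by split; apply: LG => //; apply: dL.
by split=> //; apply: gen_fieldP; right.
Qed.

Lemma gen_dfield_sub_gen_field L x : is_dfield delta L ->
  gen_field L [set x] (delta x) -> gen_dfield delta L [set x] `<=` gen_field L [set x].
Proof.
move=> dL Lx; apply: gen_dfield_min; first exact: gen_field_dfield.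
  by move=> v Lv; apply: gen_fieldP; left.
by move=> v Lv; apply: gen_fieldP; right.
Qed.

(** The difference of two solutions of [delta x = a], or the quotient of two
    solutions of [delta x = b * x], is a constant; so a constant c yields a new
    solution x0.  The last two conclusions say that any two of x, x0, c determine
    the third one rationally, in the form needed to treat both kinds of steps
    together. *)
Lemma liouville_step_shift L x M : is_dfield delta L -> L `<=` M -> M x ->
  is_dfield delta M -> countable M -> ~ alg_closure L x ->
  L (delta x) \/ L (delta x / x) ->
  exists c x0, [/\ constants delta c, ~ alg_closure M c,
    gen_field L [set x0] (delta x0),
    (forall T, is_subfield T -> T x0 -> T c -> T x) &
    (forall T, is_subfield T -> T x -> T x0 -> T c)].
Proof.
move=> dL LM Mx dM' cM nx step; have hL := dL.1.
have [c dc nc] := transcendental_constant dM' cM.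
have neq0 (u : U) (N : set U) : is_subfield N -> ~ alg_closure N u -> u != 0.
  move=> hN nu; apply/eqP => u0; apply: nu; rewrite u0.
  by apply: sub_alg_closure => //; apply: dc0.
have c0 := neq0 c M dM'.1 nc; have x0 := neq0 x L hL nx.
exists c; case: step => Lx.
- exists (x - c); split=> //.
  + by rewrite raddfB (_ : delta c = 0) // subr0; apply: gen_fieldP; left.
  + by move=> T hT T0 Tc; rewrite -(subrK c x); apply: (dcD hT).
  + move=> T hT Tx T0; have -> : c = x - (x - c) by rewrite subKr.
    exact: (dcB hT).
- exists (x / c); split=> //.
  + have -> : delta (x / c) = delta x / x * (x / c).
      rewrite dM (DV dM) ?unitfE // (_ : delta c = 0) // mulr0 oppr0 mulr0 addr0.
      by field; rewrite x0 c0.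
    apply: (dcM (gen_field_subfield _ _)); apply: gen_fieldP; [by left | by right].
  + by move=> T hT T0 Tc; rewrite -(divfK c0 x); apply: (dcM hT).
  + move=> T hT Tx T0; have -> : c = x / (x / c) by field; rewrite x0 c0.
    exact: (dc_div hT).
Qed.

(** With F = L(x0), the constant c is transcendental over F: otherwise x would be
    algebraic over L(x0), by exchange x0 over L(x), and c over L<x>.  On the other
    hand x is algebraic over L(u), so c is algebraic over F<f>, and the minimal
    polynomial of c over F<f> has constant coefficients, not all algebraic over
    F. *)
Lemma step_nonorthogonal K L m (X : set (m.-tuple U)) (f : m.-tuple U) x u :
  K `<=` L -> is_dfield delta L -> countable L -> X f -> [set` f] u ->
  ~ alg_closure L x -> L (delta x) \/ L (delta x / x) ->
  alg_closure (gen_field L [set u]) x -> nonorthogonal_to_constants delta K X.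
Proof.
move=> KL dL cL Xf fu nx step ux; have hL := dL.1.
pose M := gen_dfield delta L [set x].
have dM' : is_dfield delta M by apply: gen_dfield_dfield.
have LM : L `<=` M by move=> v Lv; apply: gen_dfieldP; left.
have Mx : M x by apply: gen_dfieldP; right.
have cM : countable M by apply: countable_gen_dfield => //; apply: countable1.
have [c [x0 [dc nc Lx0 xE cE]]] := liouville_step_shift dL LM Mx dM' cM nx step.
pose F := gen_dfield delta L [set x0].
have dF : is_dfield delta F by apply: gen_dfield_dfield.
have LF : L `<=` F by move=> v Lv; apply: gen_dfieldP; left.
have Fx0 : F x0 by apply: gen_dfieldP; right.
have Fsub : F `<=` gen_field L [set x0] by apply: gen_dfield_sub_gen_field.
have algS (N : set U) : is_subfield N -> is_subfield (alg_closure N).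
  exact: alg_closure_subfield.
have hgen (v : U) : is_subfield (gen_field L [set v]) by apply: gen_field_subfield.
have ncF : ~ alg_closure F c.
  move=> Fc; apply: nc; apply: (cE _ (algS _ dM'.1)).
    exact: sub_alg_closure dM'.1 _ Mx.
  have xF : alg_closure (gen_field L [set x0]) x.
    apply: (xE _ (algS _ (hgen _))); last exact: alg_closureS Fsub _ Fc.
    by apply: sub_alg_closure => //; apply: Fsub.
  have : alg_closure (gen_field L [set x]) x0 by apply: alg_closure_exchange.
  apply: alg_closureS; apply: smallest_sub; first exact: dM'.1.
  by move=> v [/LM|->].
pose G := gen_dfield delta F [set` f].
have dG : is_dfield delta G by apply: gen_dfield_dfield.
have FG : F `<=` G by move=> v Fv; apply: gen_dfieldP; left.
have Gc : alg_closure G c.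
  apply: (cE _ (algS _ dG.1)); last by apply: sub_alg_closure dG.1 _ _; apply: FG.
  move: ux; apply: alg_closureS; apply: smallest_sub; first exact: dG.1.
  by move=> v [/LF/FG|->] //; apply: gen_dfieldP; right.
exists F; split=> //.
- by apply: (countable_small HU); apply: countable_gen_dfield => //; apply: countable1.
- by move=> v /KL/LF.
exists f => //; apply: contrapT => noconst; apply: ncF.
apply: (alg_closure_idem dF.1); have := constant_alg_closure dM dG dc Gc.
apply: alg_closureS => d [Gd dd]; apply: contrapT => nd.
by apply: noconst; exists d.
Qed.

(** Applies [step_nonorthogonal] to the first step after which every coordinate
    of f is algebraic. *)
Lemma chain_nonorthogonal K m (X : set (m.-tuple U)) (f : m.-tuple U) s :
  is_dfield delta K -> countable K -> liouville_chain K s -> X f ->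
  [set` f] `<=` gen_dfield delta K [set` s] -> ~ algebraic_tuple K f ->
  nonorthogonal_to_constants delta K X.
Proof.
move=> dK cK cs Xf fs nf.
pose L i := gen_dfield delta K [set` take i s].
have dL i : is_dfield delta (L i) by apply: gen_dfield_dfield.
have KL i : K `<=` L i by move=> v Kv; apply: gen_dfieldP; left.
have [i [si algS nalg]] : exists i, [/\ (i < size s)%N,
    [set` f] `<=` alg_closure (L i.+1) & ~ ([set` f] `<=` alg_closure (L i))].
  apply: contrapT => noi; apply: nf.
  (* Otherwise algebraicity would descend from the whole chain to K. *)
  suff alg j : (j <= size s)%N -> [set` f] `<=` alg_closure (L (size s - j)%N).
    have := alg _ (leqnn _); rewrite subnn => f0 u /f0.
    by apply: alg_closureS; apply: gen_dfield_min => // v; rewrite take0.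
  elim: j => [_|j IHj js].
    rewrite subn0 /L take_size => u /fs; apply: sub_alg_closure.
    exact: (gen_dfield_dfield _ _ _).1.
  apply: contrapT => nalg; apply: noi; exists (size s - j.+1)%N; split=> //.
    by rewrite ltn_subrL /=; apply: leq_trans js.
  by rewrite subnSK //; apply: IHj; apply: ltnW.
have [u fu nu] : exists2 u, [set` f] u & ~ alg_closure (L i) u.
  apply: contrapT => nou; apply: nalg => u fu; apply: contrapT => nu; apply: nou.
  by exists u.
have hL := (dL i).1; have := cs i si; rewrite -/(L i) => step.
have gen (F : set U) : is_dfield delta F -> L i `<=` F -> F s`_i -> L i.+1 `<=` F.
  move=> dF LF Fs; apply: gen_dfield_min => // [v /KL/LF //|v].
  rewrite (take_nth 0) //= mem_rcons inE => /orP[/eqP -> //|vs].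
  by apply: LF; apply: gen_dfieldP; right.
have nx : ~ alg_closure (L i) s`_i.
  move=> ax; apply: nu; apply: (alg_closure_idem hL).
  apply: alg_closureS (algS _ fu); apply: gen => //.
    exact: alg_closure_dfield.
  exact: sub_alg_closure.
have Ldx : L i (delta s`_i) \/ L i (delta s`_i / s`_i).
  by case: step => //; [left | right].
have Lg : L i `<=` gen_field (L i) [set s`_i] by move=> v Lv; apply: gen_fieldP; left.
have gx : gen_field (L i) [set s`_i] s`_i by apply: gen_fieldP; right.
have ux : alg_closure (gen_field (L i) [set s`_i]) u.
  apply: alg_closureS (algS _ fu); apply: gen => //; apply: gen_field_dfield => //.
  case: Ldx => [/Lg //|/Lg Lx].
  rewrite -(@divfK _ s`_i _ (delta s`_i)).
    exact: (dcM (gen_field_subfield _ _)).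
  by apply/eqP => x0; apply: nx; rewrite x0; apply: sub_alg_closure => //; apply: dc0.
apply: (@step_nonorthogonal K (L i) m X f s`_i u) => //.
- by apply: countable_gen_dfield => //; apply: countable_seq.
- exact: alg_closure_exchange.
Qed.

End Liouville.

Theorem theorem4p6
  (U : fieldType) (delta : {additive U -> U}) (HU : is_universal delta)
  (K : set U) (HK : finitely_generated delta K)
  (m : nat) (E : set (dterm U m)) (HE : forall t, E t -> dterm_over K t)
  (n : nat) (Hn : has_order delta K (solutions delta E) n) :
  (forall y : m.-tuple U,
     generic_solution delta K (solutions delta E) n y ->
     ~ analyzable delta K y ->
     ~ liouvillian_tuple delta K y)
  /\
  (orthogonal_to_constants delta K (solutions delta E) ->
   forall f : m.-tuple U,
     solutions delta E f ->
     ~ algebraic_tuple K f ->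
     ~ liouvillian_tuple delta K f).
Proof.
have dK : is_dfield delta K by have [s ->] := HK; apply: gen_dfield_dfield.
have cK : countable K.
  have [s ->] := HK; apply: countable_gen_dfield; last exact: countable_seq.
  exact: countable0.
split=> [y _ nan /(liouvillian_tuple_chain dK)[s cs ys]|orth f Xf nalg].
  by apply: nan; apply: chain_analyzable cs ys.
move=> /(liouvillian_tuple_chain dK)[s cs fs]; apply: orth.
exact: chain_nonorthogonal cs Xf fs nalg.
Qed.
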